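(* Let $H$ be a finitely presented group and let $1\to \mathbf{Z}/2\mathbf{Z}\to\widetilde H\to H\to 1$ be an extension of $H$ by $\mathbf{Z}/2\mathbf{Z}$. Assume that $H$ contains a finitely generated subgroup $G$ such that the cohomology group $H^2(G,\mathbf{Z}/2\mathbf{Z})$ is infinite. Assume moreover that $G$ has an element of infinite order and that the preimages in $\widetilde H$ of every element of $G$ of order $2$ have order $2$. Then $\widetilde H$ has a Cayley graph that is not LG-rigid.
   Context: A ''graph'' means a connected, locally finite graph without loops or multiple edges, equipped with the geodesic metric giving each edge length $1$; ''$x\in X$'' means that $x$ is a vertex of $X$; balls are closed balls. A covering from a graph $X$ to a graph $Y$ is a graph covering map (a surjective graph morphism which, for every vertex $x$, maps the neighbors of $x$ bijectively onto the neighbors of its image); $Y$ is covered by $X$ if such a map $X\to Y$ exists. Given a finitely generated group $G$ and a finite symmetric generating set $S$, the Cayley graph $(G,S)$ is the graph with vertex set $G$ and distance $d(g,h)=|g^{-1}h|_S$ (word length). Given a graph $X$ and $R>0$, a graph $Y$ is $R$-locally $X$ if for every vertex $y\in Y$ there exists $x\in X$ such that the balls $B_X(x,R)$ and $B_Y(y,R)$, equipped with their intrinsic geodesic metrics, are isometric. $X$ is LG-rigid at scale $R$ if every graph which is $R$-locally $X$ is covered by $X$. $X$ is LG-rigid if it is LG-rigid at scale $R$ for some $R>0$. $H^2(G,\mathbf{Z}/2\mathbf{Z})$ is the second group cohomology with trivial coefficients. *)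

(* Defs.v *)
From HB Require Import structures.
From Stdlib Require Import Relation_Operators.
From mathcomp Require Import all_boot all_order all_algebra.
From mathcomp Require Import boolp classical_sets functions cardinality reals.

Set Implicit Arguments.
Unset Strict Implicit.
Unset Printing Implicit Defensive.

Import Order.TTheory GRing.Theory Num.Theory.

Local Open Scope classical_set_scope.
Local Open Scope ring_scope.

Section Groups.
Local Open Scope group_scope.
Variable G : groupType.

Definition generates (S : set G) : Prop :=
  forall g : G, exists w : seq G,
    (forall x, x \in w -> S x \/ S x^-1) /\ g = \prod_(x <- w) x.

Definition symmetric_set (S : set G) : Prop := forall s, S s -> S s^-1.

Definition finitely_generated : Prop :=
  exists2 S : set G, finite_set S & generates S.

Definition has_order (n : nat) (x : G) : Prop :=
  [/\ (0 < n)%N, x ^+ n = 1 & forall m : nat, (0 < m < n)%N -> x ^+ m <> 1].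

Definition has_infinite_order (x : G) : Prop :=
  forall n : nat, (0 < n)%N -> x ^+ n <> 1.

(* The letter (i, false) stands for the i-th generator, (i, true) for its
   formal inverse. *)
Definition word (n : nat) : Type := seq ('I_n * bool).

Definition word_eval (n : nat) (a : 'I_n -> G) (w : word n) : G :=
  \prod_(l <- w) (if l.2 then (a l.1)^-1 else a l.1).

Inductive rewrite_step (n : nat) (rels : seq (word n)) :
    word n -> word n -> Prop :=
| Cancel (u v : word n) (l : 'I_n * bool) :
    rewrite_step rels (u ++ [:: l; (l.1, ~~ l.2)] ++ v) (u ++ v)
| Relator (u v r : word n) :
    r \in rels -> rewrite_step rels (u ++ r ++ v) (u ++ v).

(* The classes of this congruence are the elements of the group presented by
   generators 'I_n and relators rels. *)
Definition presented_eq (n : nat) (rels : seq (word n)) :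
    word n -> word n -> Prop :=
  clos_refl_sym_trans (word n) (rewrite_step rels).

Definition finitely_presented : Prop :=
  exists (n : nat) (a : 'I_n -> G) (rels : seq (word n)),
    (forall h : G, exists w, word_eval a w = h) /\
    (forall u v, word_eval a u = word_eval a v <-> presented_eq rels u v).

End Groups.

(* H^2(G, Z/2Z), trivial coefficients, as the set of cosets of the group of
   inhomogeneous 2-coboundaries in the group of inhomogeneous 2-cocycles. *)
Section Cohomology.
Variable G : groupType.

Definition cocycle2 : set (G -> G -> 'Z_2) :=
  [set f | forall g h k : G,
     f h k - f (g * h)%g k + f g (h * k)%g - f g h = 0].

Definition coboundary1 (c : G -> 'Z_2) (g h : G) : 'Z_2 :=
  c h - c (g * h)%g + c g.

Definition coset_coboundary (f : G -> G -> 'Z_2) : set (G -> G -> 'Z_2) :=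
  [set f' | exists c : G -> 'Z_2,
     forall g h, f' g h = f g h + coboundary1 c g h].

Definition H2 : set (set (G -> G -> 'Z_2)) := coset_coboundary @` cocycle2.

End Cohomology.

(* Nonemptiness belongs to connectedness: the empty graph would be r-locally X
   for every X, but is never covered by a nonempty graph. *)
Record graph : Type := Graph {
  vertex :> Type;
  adj : vertex -> vertex -> Prop;
  adj_sym : forall x y, adj x y -> adj y x;
  adj_irrefl : forall x, ~ adj x x;
  graph_nonempty : inhabited vertex;
  graph_connected : forall x y, clos_refl_trans vertex adj x y;
  graph_locally_finite : forall x, finite_set [set y | adj x y]
}.

Definition covering (X Y : graph) (f : X -> Y) : Prop :=
  [/\ set_surj [set: X] [set: Y] f,
      forall x x' : X, adj x x' -> adj (f x) (f x') &
      forall x : X, set_bij [set x' | adj x x'] [set y | adj (f x) y] f].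

Definition covered_by (Y X : graph) : Prop := exists f : X -> Y, covering f.

(* Points of the geometric realization of X are given by their barycentric
   coordinates X -> R. *)
Section Metric.
Variables (R : realType) (X : graph).

Definition vertex_pt (x : X) : X -> R := fun w => (`[< w = x >] : bool)%:R.

Definition edge_pt (u v : X) (t : R) : X -> R :=
  fun w => (1 - t) * vertex_pt u w + t * vertex_pt v w.

(* The case of vertex_pt only matters for the one-vertex graph. *)
Definition realization : set (X -> R) :=
  [set p | (exists x, p = vertex_pt x) \/
           exists u v t, [/\ adj u v, 0 <= t <= 1 & p = edge_pt u v t]].

(* piecewise_linear A p q l: some path from p to q inside A is a finite
   concatenation of segments of edges of total length l. *)
Inductive piecewise_linear (A : set (X -> R)) :
    (X -> R) -> (X -> R) -> R -> Prop :=
| PLnil (p : X -> R) : A p -> piecewise_linear A p p 0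
| PLcons (u v : X) (s t : R) (q : X -> R) (l : R) :
    adj u v -> 0 <= s <= 1 -> 0 <= t <= 1 ->
    (forall c, Num.min s t <= c <= Num.max s t -> A (edge_pt u v c)) ->
    piecewise_linear A (edge_pt u v t) q l ->
    piecewise_linear A (edge_pt u v s) q (`|s - t| + l).

(* The intrinsic (length) metric of A; meaningful when any two points of A are
   joined by a piecewise linear path in A, as is the case for the realization
   and for balls centred at vertices. *)
Definition intrinsic_dist (A : set (X -> R)) (p q : X -> R) : R :=
  inf [set l | piecewise_linear A p q l].

Definition gball (x : X) (r : R) : set (X -> R) :=
  [set p | realization p /\ intrinsic_dist realization (vertex_pt x) p <= r].

End Metric.

Definition isometric (R : realType) (X Y : graph)
    (A : set (X -> R)) (B : set (Y -> R)) : Prop :=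
  exists f : (X -> R) -> (Y -> R),
    set_bij A B f /\
    forall p q, A p -> A q ->
      intrinsic_dist B (f p) (f q) = intrinsic_dist A p q.

Definition is_locally (R : realType) (r : R) (X Y : graph) : Prop :=
  forall y : Y, exists x : X, isometric (gball x r) (gball y r).

Definition LG_rigid_at (R : realType) (r : R) (X : graph) : Prop :=
  forall Y : graph, is_locally r X Y -> covered_by Y X.

Definition LG_rigid (R : realType) (X : graph) : Prop :=
  exists r : R, 0 < r /\ LG_rigid_at r X.

Section Cayley.
Local Open Scope group_scope.
Variables (G : groupType) (S : set G).
Hypotheses (finS : finite_set S) (symS : symmetric_set S)
  (genS : generates S).

(* |g^-1 h|_S = 1; S is allowed to contain 1, which creates no loop. *)
Definition cayley_adj (g h : G) : Prop := g <> h /\ S (g^-1 * h).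

Lemma cayley_adj_sym g h : cayley_adj g h -> cayley_adj h g.
Proof.
move=> [gh Sgh]; split; first exact: nesym.
by have := symS Sgh; rewrite invgM invgK.
Qed.

Lemma cayley_adj_irrefl g : ~ cayley_adj g g.
Proof. by case. Qed.

Lemma cayley_connected g h : clos_refl_trans G cayley_adj g h.
Proof.
have [w [Sw /(congr1 (fun x => g * x))]] := genS (g^-1 * h).
rewrite mulVKg => ->.
elim: w g Sw => [|x w IHw] g Sw; first by rewrite big_nil mulg1; exact: rt_refl.
have Sx : S x.
  by have [//|/symS] := Sw x (mem_head _ _); rewrite invgK.
rewrite big_cons mulgA; apply: (@rt_trans _ _ _ (g * x)); last first.
  by apply: IHw => y yw; apply: Sw; rewrite inE yw orbT.
have [<-|/eqP gx] := eqVneq g (g * x); first exact: rt_refl.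
by apply: rt_step; split=> //; rewrite mulgA mulVg mul1g.
Qed.

Lemma cayley_locally_finite g : finite_set [set h | cayley_adj g h].
Proof.
apply: (@sub_finite_set _ _ ((fun x => g * x) @` S)); last exact: finite_image.
by move=> h [_ Sgh]; exists (g^-1 * h) => //; rewrite mulVKg.
Qed.

Definition cayley_graph : graph :=
  Graph cayley_adj_sym cayley_adj_irrefl (inhabits 1) cayley_connected
    cayley_locally_finite.

End Cayley.

(* Main.v *)
From Stdlib Require Import Relation_Operators Operators_Properties.
Require Import Defs.
From mathcomp Require Import all_boot all_order all_algebra.
From mathcomp Require Import boolp classical_sets functions cardinality reals.
From mathcomp Require Import zify ring lra.

(* Write [z] for the non-trivial element of the kernel of [pi].  The Cayley
   graph is taken with respect to [z], all lifts of the elements of a finite set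
   [A] of "fat" labels of [H], and one lift of each element of a finite set [B]
   of "thin" labels, which generates [G].  A 2-cocycle [f] of [G] twists this
   graph [X] into a graph [Y]: the thin edge labelled [b] at [x] is multiplied
   by [z ^ f (pi x, b)].  If [f] vanishes on a large enough finite set, then [Y]
   is locally [X].

   A covering of [Y] by [X] descends to a map of [H].  The edges labelled by
   [z] are those lying in the largest number of triangles, and [A] is chosen
   such that the number of fat-fat-thin triangles on a thin edge determines its
   label up to inversion.  So the restriction to [G] of the map on [H] preserves
   the labels in [B] up to inversion, and because [G] has an element of infinite
   order, such a map is determined by its value at 1 and by finitely many signs.
   Two twists which are covered through the same map of [G] have cohomologous
   cocycles.  Hence only finitely many classes of [H^2(G, Z/2Z)] give a graph
   covered by [X], and infinitely many have representatives vanishing on the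
   given finite set. *)

Set Implicit Arguments.
Unset Strict Implicit.
Unset Printing Implicit Defensive.

Import Order.TTheory GRing.Theory Num.Theory.

Local Open Scope classical_set_scope.

(** * Rigidity of label-preserving maps *)

Ltac gsimp := rewrite ?(invgM, invgK, invg1, mulgA, mulgK, mulgVK, mulVg, mulgV, mul1g, mulg1).

(** * Products of a bounded number of letters *)

Section WordBalls.
Local Open Scope group_scope.
Variable H : groupType.
Implicit Types (T : seq H) (x y : H) (n : nat).

(** Words have exactly [n] letters; once [1] is a letter the lists increase with [n] ([wballW]) and
    serve as balls. *)
Fixpoint wball T n : seq H :=
  if n is n'.+1 then [seq x * y | x <- wball T n', y <- T] else [:: 1].

Lemma wballM T m n x y :
  x \in wball T m -> y \in wball T n -> x * y \in wball T (m + n).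
Proof.
elim: n y => [|n IHn] y xm; first by rewrite /= inE addn0 => /eqP ->; rewrite mulg1.
case/allpairsP=> -[u t] /= [un tT ->]; rewrite addnS mulgA.
by apply: allpairs_f => //; exact: IHn.
Qed.

Lemma wball1 T x : x \in T -> x \in wball T 1.
Proof. by move=> xT; rewrite -[x]mul1g; apply: allpairs_f; rewrite ?inE. Qed.

Lemma wballV T n x : (forall t, t \in T -> t^-1 \in T) ->
  x \in wball T n -> x^-1 \in wball T n.
Proof.
move=> TV; elim: n x => [|n IHn] x; first by rewrite inE => /eqP ->; rewrite invg1 inE.
case/allpairsP=> -[u t] /= [un tT ->]; rewrite invgM; change (t^-1 * u^-1 \in wball T (1 + n)).
by apply: wballM; [apply/wball1/TV | exact: IHn].
Qed.

Lemma wballW T m n x : 1 \in T -> m <= n -> x \in wball T m -> x \in wball T n.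
Proof.
move=> T1 /subnKC <- xm; rewrite -[x]mulg1; apply: wballM => //.
elim: (n - m)%N => [|k IHk]; first by rewrite inE.
by rewrite -[1]mulg1; exact: allpairs_f.
Qed.

End WordBalls.

Section Rigidity.
Local Open Scope group_scope.
Variables (H : groupType) (T : seq H) (g : H).
Hypotheses (T1 : 1 \in T) (gT : g \in T) (TV : forall t, t \in T -> t^-1 \in T)
  (ginf : has_infinite_order g).

(** The sign may vary with [x] and [t]. Four letters are allowed because [keeps_labels_step]
    compares points through labels such as [g^-1 * s'^-1 * s * t]. *)
Definition keeps_labels (q : H -> H) : Prop :=
  forall x t, t \in wball T 4 -> q (x * t) = q x * t \/ q (x * t) = q x * t^-1.

Let w2 s t : s \in T -> t \in T -> s * t \in wball T 4.
Proof. by move=> sT tT; apply: (@wballW _ _ 2) => //; apply: (@wballM _ _ 1 1); exact: wball1. Qed.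

Let w4 s t u v : s \in T -> t \in T -> u \in T -> v \in T -> s * t * u * v \in wball T 4.
Proof.
move=> sT tT uT vT; apply: (@wballM _ _ 3 1); last exact: wball1.
apply: (@wballM _ _ 2 1); last exact: wball1.
by apply: (@wballM _ _ 1 1); exact: wball1.
Qed.

Lemma keeps_labels_comp q1 q2 :
  keeps_labels q1 -> keeps_labels q2 -> keeps_labels (q2 \o q1).
Proof.
move=> k1 k2 x t tT /=; have tVT := wballV TV tT.
have [|] := k1 x t tT => ->; first exact: k2.
by have [|] := k2 (q1 x) _ tVT => ->; rewrite ?invgK; [right|left].
Qed.

Ltac gby E a b := move: (congr1 (fun w => a * w * b) E) => /=; gsimp; by [].

(* Translate so that [x = q x = 1] and suppose that [q (s * t) = s * t^-1] with
   [t^-1 <> t].  Comparison with the fixed points [s'] and [s' * g], for [s'] in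
   [T], shows that [t] inverts [g] and all [s'^-1 * s] and [g^-1 * s'^-1 * s].
   Then [s] and [t] commute with [g], so [g] would have order 2. *)
Lemma keeps_labels_step q x : keeps_labels q -> (forall s, s \in T -> q (x * s) = q x * s) ->
  forall s t, s \in T -> t \in T -> q (x * s * t) = q x * s * t.
Proof.
move=> kq qx; pose u h := (q x)^-1 * q (x * h).
have us s : s \in T -> u s = s by move=> sT; rewrite /u qx // mulKg.
have uP h t : t \in wball T 4 -> u (h * t) = u h * t \/ u (h * t) = u h * t^-1.
  by move=> /(kq (x * h)); rewrite /u !mulgA => -[] ->; gsimp; [left|right].
have g2 : g * g <> 1 by apply: (@ginf 2).
have g4 : g * g * g * g <> 1 by rewrite -!mulgA; apply: (@ginf 4).
have gVT := TV gT.
have w1 t : t \in T -> t \in wball T 4 by move=> tT; rewrite -[t]mulg1; apply: w2.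
have g4T := w1 _ gT.
have usg s : s \in T -> u (s * g) = s * g.
  move=> sT.
  (* If [s * g] went to [s * g^-1], then [s * g * g] would go to [s * g^-1 * g^-1]. Comparing both
     with the fixed point [1] gives [s = s^-1] and [s * g = g * s]; comparing [s * g * g] with the
     fixed point [g] then gives [g ^+ 2 = 1] or [g ^+ 4 = 1]. *)
  have := uP s g g4T; rewrite (us s) // => -[//|E1].
  have E2 : u (s * g * g) = s * g^-1 * g^-1.
    have [|] := uP s (g * g) (w2 gT gT); rewrite (us s) // mulgA => E2; last by rewrite E2; gsimp.
    have [|] := uP (s * g) g g4T; rewrite E2 E1 => E3.
      by case: g2; gby E3 (s^-1) (1 : H).
    by case: g4; gby E3 (s^-1) (g * g).
  have := uP 1 (s * g) (w2 sT gT); rewrite mul1g (us 1) // mul1g E1 => -[E3|].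
    by case: g2; gby (esym E3) (s^-1) g.
  rewrite mul1g invgM => E3.
  have [|] := uP 1 (s * g * g * 1) (w4 sT gT gT T1); rewrite mul1g mulg1 (us 1) // mul1g E2 => E4.
    by case: g4; gby (esym E4) (s^-1) (g * g).
  have s2 : s = s^-1.
    apply: (mulIg g^-1); rewrite E3; apply: (mulgI g^-1).
    by rewrite !invgM in E4; rewrite -E4 E3 mulgA.
  have sg : s * g = g * s by rewrite -s2 in E3; gby (esym E3) g g.
  have [|] := uP g (g^-1 * s * g * g) (w4 gVT sT gT gT); rewrite (us g) //; gsimp; rewrite E2.
    by move=> E; case: g4; gby (esym E) (s^-1) (g * g).
  by rewrite -mulgA -s2 sg; gsimp => E; case: g2; gby (esym E) (s^-1) (g * g).
have ust s t : s \in T -> t \in T -> u (s * t) = s * t.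
  move=> sT tT; have := uP s t (w1 _ tT); rewrite (us s) // => -[//|E0].
  have [t2|t2] := eqVneq t t^-1; first by rewrite [in RHS]t2 -t2 E0 -t2.
  have K h : u h = h -> h^-1 * s * t \in wball T 4 ->
      h^-1 * s * t^-1 = t^-1 * s^-1 * h.
    move=> uh /(uP h); rewrite uh !mulgA mulgV mul1g E0 => -[E|E].
      by move/eqP: t2; case; apply: (mulgI s).
    by rewrite -[LHS]mulgA E; gsimp.
  have wgt s' : s' \in T -> g^-1 * s'^-1 * s * t^-1 = t^-1 * s^-1 * s' * g.
    move=> s'T; have := K _ (usg _ s'T); rewrite invgM => -> //.
      by rewrite !mulgA.
    by apply: w4 => //; exact: TV.
  have wt s' : s' \in T -> s'^-1 * s * t^-1 = t^-1 * s^-1 * s'.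
    move=> s'T; apply: K; first exact: us.
    by rewrite -[_ * t]mulg1; apply: w4 => //; exact: TV.
  have tg : g^-1 * t^-1 = t^-1 * g by have := wgt s sT; gsimp.
  have cg s' : s' \in T -> g * (s^-1 * s') = s^-1 * s' * g.
    move=> s'T; apply: (mulgI t^-1).
    rewrite !mulgA -(wgt s' s'T) -tg.
    by gby (esym (wt s' s'T)) (g^-1) (1 : H).
  have sg : g * s = s * g by have := cg 1 T1; gsimp => E; gby (esym E) s s.
  have tgC : g * t = t * g.
    apply: (mulgI s^-1); have := cg t tT; gsimp => <-.
    by congr (_ * t); gby (esym sg) (s^-1) (s^-1).
  case: g2; move: (congr1 (fun w => t * w * t * g) tg); gsimp => E.
  by apply: (mulgI t); rewrite mulg1 mulgA -tgC -E.
move=> s t sT tT; have := ust s t sT tT; rewrite /u mulgA => E.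
by apply: (mulgI (q x)^-1); rewrite E; gsimp.
Qed.

Let w1 t : t \in T -> t \in wball T 4.
Proof. by move=> tT; rewrite -[t]mulg1; apply: w2. Qed.

Lemma keeps_labels_id q n x : keeps_labels q -> q 1 = 1 ->
  (forall s, s \in T -> q s = s) -> x \in wball T n -> q x = x.
Proof.
move=> kq q1 qT xn.
(* The induction also carries the values at the neighbours [x * s], since this is what
   [keeps_labels_step] propagates. *)
suff: q x = x /\ forall s, s \in T -> q (x * s) = q x * s by case.
elim: n x xn => [x|n IHn x].
  by rewrite inE => /eqP ->; split=> // s sT; rewrite q1 !mul1g qT.
case/allpairsP=> -[u t] /= [un tT ->]; have [qu qut] := IHn u un; split.
  by rewrite qut // qu.
by move=> s sT; rewrite (keeps_labels_step kq qut) // qut.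
Qed.

Lemma keeps_labels_gen q n x : keeps_labels q -> q 1 = 1 ->
  x \in wball T n -> q x \in wball T n.
Proof.
move=> kq q1; elim: n x => [x|n IHn x]; first by rewrite !inE => /eqP ->; rewrite q1.
case/allpairsP=> -[u t] /= [un tT ->].
by have [|] := kq u t (w1 tT) => ->; apply: allpairs_f; rewrite ?IHn ?TV.
Qed.

Definition rooted_labelling q :=
  [/\ keeps_labels q, q 1 = 1 & {in T &, injective q}].

(* [q \o q] fixes [T] pointwise because [q] acts on [T] by signs. *)
Lemma rooted_labelling_invol q n x :
  rooted_labelling q -> x \in wball T n -> q (q x) = x.
Proof.
case=> kq q1 qI; apply: (keeps_labels_id (keeps_labels_comp kq kq)) => /=.
  by rewrite !q1.
move=> s sT; have [sV|sV] := eqVneq s s^-1.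
  by have [] := kq 1 s (w1 sT); rewrite q1 !mul1g -?sV => qs; rewrite !qs.
have [] := kq 1 s (w1 sT); rewrite q1 !mul1g => qs; rewrite !qs //.
have [] := kq 1 _ (w1 (TV sT)); rewrite q1 !mul1g ?invgK => qsV //.
by case/eqP: sV; apply: qI; rewrite ?qs ?TV.
Qed.

(** As [q2] is an involution on [T], the composite [q2 \o q1] fixes [T] and hence every ball.
    Evaluate it at [q1 x], using that [q1] is an involution too. *)
Lemma rooted_labelling_uniq q1 q2 n x :
  rooted_labelling q1 -> rooted_labelling q2 -> {in T, q1 =1 q2} ->
  x \in wball T n -> q1 x = q2 x.
Proof.
move=> r1 r2 q12 xn; have [k1 q11 _] := r1; have [k2 q21 _] := r2.
have q2q1 y : y \in wball T n -> q2 (q1 y) = y.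
  apply: (keeps_labels_id (keeps_labels_comp k1 k2)) => /=; first by rewrite q11.
  by move=> s sT; rewrite q12 // (rooted_labelling_invol r2 (wball1 sT)).
by rewrite -[in RHS](rooted_labelling_invol r1 xn) q2q1 // keeps_labels_gen.
Qed.

End Rigidity.

(** * Choice of the fat labels *)

Definition eventually_nat (Q : nat -> Prop) : Prop :=
  exists N : nat, forall e, (N <= e)%N -> Q e.

Lemma ev_and Q1 Q2 : eventually_nat Q1 -> eventually_nat Q2 ->
  eventually_nat (fun e => Q1 e /\ Q2 e).
Proof.
move=> [N1 Q1N] [N2 Q2N]; exists (maxn N1 N2) => e.
by rewrite geq_max => /andP[? ?]; split; [exact: Q1N | exact: Q2N].
Qed.

Lemma ev_mono (Q1 Q2 : nat -> Prop) : (forall e, Q1 e -> Q2 e) ->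
  eventually_nat Q1 -> eventually_nat Q2.
Proof. by move=> Q12 [N QN]; exists N => e /QN/Q12. Qed.

Lemma ev_all (T : eqType) (s : seq T) (Q : T -> nat -> Prop) :
  (forall x, x \in s -> eventually_nat (Q x)) ->
  eventually_nat (fun e => forall x, x \in s -> Q x e).
Proof.
elim: s => [|y s IHs] Qs; first by exists 0.
have := ev_and (Qs y (mem_head _ _)) (IHs (fun x xs => Qs x (mem_behead (s := y :: s) xs))).
by apply: ev_mono => e [Qy Qse] x; rewrite inE => /orP[/eqP -> //|]; exact: Qse.
Qed.

(** Such a [Q] holds at most once. The unwanted coincidences below are equations in powers of [h],
    excluded by showing that two exponents cannot both solve them. *)
Lemma ev_not (Q : nat -> Prop) :
  (forall e1 e2, (e1 < e2)%N -> Q e1 -> Q e2 -> False) ->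
  eventually_nat (fun e => ~ Q e).
Proof.
move=> Q1; have [[e Qe]|nQ] := pselect (exists e, Q e).
  by exists e.+1 => e' ee' Qe'; exact: Q1 ee' Qe Qe'.
by exists 0 => e _ Qe; apply: nQ; exists e.
Qed.

Lemma count_mem_le (T S : eqType) (f : T -> S) (s : seq T) (r : seq S) :
  injective f -> uniq s -> count (fun x => f x \in r) s <= size r.
Proof.
move=> fI us; rewrite -size_filter -(size_map f); apply: uniq_leq_size.
  by rewrite map_inj_uniq // filter_uniq.
by move=> y /mapP[x]; rewrite mem_filter => /andP[fx _] ->.
Qed.

(** * Counting factorizations into two fat labels *)

Section FatSet.
Local Open Scope group_scope.
Variable H : groupType.
Implicit Types (A B D L U V P : seq H) (g h w x y t : H).

(** For a duplicate-free [A], this is the number of triangles with two fat sides on an edge labelled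
    [y] of the graph on [H]. *)
Definition fat_count A y : nat := count (fun a => a^-1 * y \in A) A.

Definition separated A D : Prop :=
  forall x y, x \in D -> y \in D -> fat_count A x = fat_count A y ->
  y = x \/ y = x^-1.

(** A factorization [x = a * b] gives [x^-1 = b^-1 * a^-1]. This is why [separated] can only ask for
    equality up to inversion. *)
Lemma fat_countV A y : uniq A -> (forall a, a \in A -> a^-1 \in A) ->
  fat_count A y^-1 = fat_count A y.
Proof.
move=> uA AV; suff le x : fat_count A x <= fat_count A x^-1.
  by apply/eqP; rewrite eqn_leq le andbT -[in leqRHS](invgK y) le.
rewrite /fat_count -!size_filter -(size_map (fun a => x^-1 * a)).
apply: uniq_leq_size; first by rewrite map_inj_uniq ?filter_uniq //; exact: mulgI.
move=> b /mapP[a]; rewrite !mem_filter => /andP[ax aA] ->; gsimp.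
by rewrite (AV _ aA) /=; have := AV _ ax; rewrite invgM invgK.
Qed.

Lemma inf_order_inj h m n : has_infinite_order h -> h ^+ m = h ^+ n -> m = n.
Proof.
move=> hinf; wlog mn : m n / m <= n.
  by move=> W; have /orP[mn|nm] := leq_total m n => [|/esym]; move/W => /(_ _) <-.
move=> E; apply/eqP; rewrite eqn_leq mn /= leqNgt -subn_gt0; apply/negP => lt.
apply: (hinf _ lt); apply: (mulgI (h ^+ m)).
by rewrite -expgnDr subnKC // mulg1.
Qed.

Definition inverts h w : bool := w * h == h^-1 * w.

(** Two exponents solving the same equation only yield a relation between [w] and a power of [h];
    genericity turns it into a relation with [h] itself. *)
Definition generic h w : Prop :=
  (forall d, 0 < d -> w * h ^+ d = h ^- d * w -> w * h = h^-1 * w) /\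
  (forall d, 0 < d -> w * h ^+ d = h ^+ d * w -> w * h = h * w).

Lemma inverts_exp h w n : w * h = h^-1 * w -> w * h ^+ n = h ^- n * w.
Proof.
move=> E; elim: n => [|n IHn]; first by rewrite expg0 invg1 mulg1 mul1g.
by rewrite [in LHS]expgSr mulgA IHn -mulgA E [in RHS]expgS invgM mulgA.
Qed.

Lemma generic_exp h w k : generic h w -> generic (h ^+ k) w.
Proof.
case: k => [|k] [gi gc].
  by split=> d _ _; rewrite expg0 ?invg1 mulg1 mul1g.
split=> d d0; rewrite -expgnA => E.
  by apply: inverts_exp; apply: gi E; rewrite muln_gt0.
by apply: (@commuteX _ w h); apply: gc E; rewrite muln_gt0.
Qed.

(** A relation of [w] with one power of [h] persists for its multiples. So for each [w] in turn the
    exponent is multiplied by one at which [w] inverts, and one at which it centralizes, the power,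
    or by 1 if there is none. *)
Lemma exists_generic g (s : seq H) : exists2 M : nat, 0 < M &
  forall w, w \in s -> generic (g ^+ M) w.
Proof.
elim: s => [|w s [M M0 IHs]]; first by exists 1%N.
set h := g ^+ M in IHs.
have W (E : nat -> Prop) : exists2 d, 0 < d & forall e, 0 < e -> E e -> E d.
  have [[e e0 Ee]|nE] := pselect (exists2 e, 0 < e & E e); first by exists e.
  by exists 1%N => // e e0 Ee; case: nE; exists e.
have [d1 d10 Ed1] := W (fun d => w * h ^+ d = h ^- d * w).
have [d2 d20 Ed2] := W (fun d => w * h ^+ d = h ^+ d * w).
exists (M * (d1 * d2))%N; first by rewrite !muln_gt0 M0 d10 d20.
move=> v; rewrite expgnA -/h inE => /orP[/eqP ->|/IHs]; last exact: generic_exp.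
split=> d d0; rewrite -expgnA => E.
  rewrite expgnA; apply: inverts_exp; apply: Ed1 E.
  by rewrite !muln_gt0 d10 d20.
rewrite mulnC expgnA; apply: (@commuteX _ w (h ^+ d2)); apply: Ed2 E.
by rewrite !muln_gt0 d10 d20.
Qed.

(** * Fat labels which raise the count of one thin label *)

Section Generic.
Variable h : H.
Hypothesis hinf : has_infinite_order h.

Let split_exp e1 e2 : e1 < e2 -> exists2 d, 0 < d &
  h ^+ e2 = h ^+ e1 * h ^+ d /\ h ^+ e2 = h ^+ d * h ^+ e1.
Proof.
move=> lt; exists (e2 - e1)%N; first by rewrite subn_gt0.
by rewrite -!expgnDr subnKC ?subnK // ltnW.
Qed.

(** In this lemma and the next two, eliminating [w] from the two equations shows that [y]
    centralizes or inverts [h ^+ (e2 - e1)]. By genericity it does the same to [h], and then the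
    powers of [h] cancel. *)
Lemma generic_conj w y e1 e2 : generic h y -> e1 < e2 ->
  h ^- e1 * w * h ^+ e1 = y -> h ^- e2 * w * h ^+ e2 = y -> w = y.
Proof.
move=> [_ gc] /split_exp[d d0 [-> _]] E1; rewrite invgM !mulgA => E2.
have yh : y * h = h * y.
  apply: gc d0 _; apply: (mulgI (h ^- d)); rewrite !mulgA mulVg mul1g -[RHS]E2 -E1.
  by rewrite !mulgA.
by rewrite -[RHS](mulgK (h ^+ e1)) (@commuteX _ y h e1 yh) -E1; gsimp.
Qed.

Lemma generic_twist w y e1 e2 : generic h y -> e1 < e2 ->
  h ^+ e1 * w * h ^+ e1 = y -> h ^+ e2 * w * h ^+ e2 = y -> w = y /\ inverts h y.
Proof.
move=> [gi _] /split_exp[d d0 [E E']] E1; rewrite {1}E' E !mulgA => E2.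
have yh : y * h = h^-1 * y.
  apply: gi d0 _; apply: (mulgI (h ^+ d)); rewrite !mulgA mulgV mul1g -[RHS]E2 -E1.
  by rewrite !mulgA.
split; last by rewrite /inverts yh.
by move: (inverts_exp e1 yh); rewrite -E1; gsimp => /mulIg.
Qed.

Lemma generic_twistV w y e1 e2 : generic h y -> e1 < e2 ->
  h ^- e1 * w * h ^- e1 = y -> h ^- e2 * w * h ^- e2 = y -> w = y /\ inverts h y.
Proof.
move=> [gi _] /split_exp[d d0 [E E']] E1; rewrite {1}E E' !invgM !mulgA => E2.
have yh : y * h = h^-1 * y.
  apply: gi d0 _; apply: (mulIg (h ^- d)); rewrite mulgK -[LHS]E2 -E1.
  by rewrite !mulgA.
split; last by rewrite /inverts yh.
by move: (inverts_exp e1 yh); rewrite -E1; gsimp; rewrite -!mulgA => /mulgI.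
Qed.

(* Adding [quad t e] to the fat labels creates the triangle
   [h ^+ e * (h ^- e * t) = t] on [t].  For large [e] all other triangles that
   it creates lie on [t^-1] or, if [t] inverts [h], on labels which do not
   invert [h], such as [t * t]; so the labels inverting [h] have to be
   processed first in [separating_extension]. *)
Definition quad t e := [:: h ^+ e; h ^- e; h ^- e * t; t^-1 * h ^+ e].

Lemma quadV t e a : a \in quad t e -> a^-1 \in quad t e.
Proof.
by rewrite !inE => /or4P[] /eqP ->; gsimp; rewrite eqxx ?orbT.
Qed.

Lemma ev_quad_neq t v : eventually_nat (fun e => v \notin quad t e).
Proof.
have hI := inf_order_inj hinf.
have E1 : eventually_nat (fun e => ~ (h ^+ e = v)).
  by apply: ev_not => e1 e2 lt <- /hI e; rewrite e ltnn in lt.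
have E2 : eventually_nat (fun e => ~ (h ^- e = v)).
  by apply: ev_not => e1 e2 lt <- /invg_inj/hI e; rewrite e ltnn in lt.
have E3 : eventually_nat (fun e => ~ (h ^- e * t = v)).
  by apply: ev_not => e1 e2 lt <- /mulIg/invg_inj/hI e; rewrite e ltnn in lt.
have E4 : eventually_nat (fun e => ~ (t^-1 * h ^+ e = v)).
  by apply: ev_not => e1 e2 lt <- /mulgI/hI e; rewrite e ltnn in lt.
apply: ev_mono (ev_and (ev_and E1 E2) (ev_and E3 E4)) => e [[n1 n2] [n3 n4]].
by apply/negP; rewrite !inE => /or4P[] /eqP/esym.
Qed.

Definition affects t y := [|| y == t, y == t^-1 | inverts h t && ~~ inverts h y].

Lemma invertsV t : inverts h t -> inverts h t^-1.
Proof.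
move=> /eqP E; apply/eqP.
by move: (congr1 (fun w => t^-1 * h * w * h^-1 * t^-1) E); gsimp.
Qed.

Lemma inverts_sq t : inverts h t -> inverts h (t * t) -> False.
Proof.
move=> /eqP E /eqP; rewrite -mulgA E !mulgA => /mulIg; rewrite -E => /mulgI hV.
by apply: (@hinf 2); rewrite // expg2 -{1}hV mulVg.
Qed.

(** Of the sixteen products of two elements of [quad t e], six are independent of [e] and equal [1],
    [t] or [t^-1]. Each of the other ten equals an unaffected [y] for at most one [e]. *)
Lemma ev_quad_mul B t : (forall b, b \in B -> b^-1 \in B) -> 1 \notin B -> t \in B ->
  (forall b c, b \in B -> c \in 1 :: B -> generic h (b * c) /\ generic h (c * b)) ->
  eventually_nat (fun e => forall y, y \in B -> forall a, a \in quad t e ->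
    a^-1 * y \in quad t e -> affects t y).
Proof.
move=> BV B1 tB Bgen; apply: ev_all => y yB.
have [ok|nok] := boolP (affects t y); first by exists 0.
have y1 : y <> 1 by move=> E; rewrite -E yB in B1.
have gy : generic h y by have [] := Bgen y 1 yB (mem_head _ _); rewrite mulg1.
have gyt : generic h (y * t^-1).
  by have [] := Bgen y t^-1 yB _; rewrite // inE BV ?orbT.
have gty : generic h (t * y).
  by have [] := Bgen t y tB _; rewrite // inE yB ?orbT.
have [yt ytV invy] : [/\ y <> t, y <> t^-1 & inverts h t -> inverts h y].
  move: nok; rewrite /affects => /norP[/eqP yt /norP[/eqP ytV]] /nandP inv.
  by split=> // it; case: inv => [|/negPn //]; rewrite it.
have hI := inf_order_inj hinf.
suff E (i j : nat) : eventually_nat (fun e => i < 4 -> j < 4 ->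
    nth 1 (quad t e) i * nth 1 (quad t e) j <> y).
  have := ev_all (s := [seq (i, j) | i <- iota 0 4, j <- iota 0 4]) (fun p _ => E p.1 p.2).
  apply: ev_mono => e {}E a /(nthP 1)[i i4 <-] /(nthP 1)[j j4 Ej].
  case: (E (i, j) _ i4 j4); first by apply: allpairs_f; rewrite mem_iota.
  by rewrite Ej mulVKg.
have nlt (m n : nat) : m < n -> m = n -> False by move=> + E0; rewrite E0 ltnn.
have nlt2 (m n : nat) : m < n -> (m + m)%N = (n + n)%N -> False by lia.
have ev0 (Q : nat -> Prop) : eventually_nat (fun e => ~ Q e) ->
    eventually_nat (fun e => i < 4 -> j < 4 -> ~ Q e) by apply: ev_mono.
case: i ev0 => [|[|[|[|i]]]] ev0; last by exists 0.
all: case: j ev0 => [|[|[|[|j]]]] ev0; last by exists 0.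
all: apply: ev0; apply: ev_not => e1 e2 lt /=; gsimp; try by move/esym.
- by move=> <-; rewrite -!expgnDr => /hI /esym; exact: nlt2.
- by move=> E1 E2; have [/esym] := generic_twist gy lt E1 E2.
- by move=> <-; rewrite -!invgM -!expgnDr => /invg_inj/hI /esym; exact: nlt2.
- by move=> <- /mulIg; rewrite -!invgM -!expgnDr => /invg_inj/hI /esym; exact: nlt2.
- by move=> E1 E2; have /esym := generic_conj gy lt E1 E2.
- by move=> E1 E2; have /esym := generic_conj gy lt E1 E2.
- by move=> E1 E2; have [/esym] := generic_twistV gy lt E1 E2.
(* The square of [h ^- e * t] is the delicate product: two solutions give [y = t * t] with [t]
   inverting [h]. An unaffected [y] then inverts [h], but [t * t] centralizes it. The square of
   [t^-1 * h ^+ e] is treated likewise at the end. *)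
- have tw e : h ^- e * t / h ^+ e * t = y -> h ^- e * t * h ^- e = y * t^-1.
    by move=> <-; gsimp.
  move=> /tw E1 /tw E2; have [tyt it] := generic_twistV gyt lt E1 E2.
  rewrite -tyt in it; have := invy it; rewrite -[y](mulgVK t) -tyt.
  exact: inverts_sq.
- by move=> <-; rewrite -!mulgA => /mulgI; rewrite -!expgnDr => /hI /esym; exact: nlt2.
have tw e : t^-1 * h ^+ e / t * h ^+ e = y -> h ^+ e * t^-1 * h ^+ e = t * y.
  by move=> <-; gsimp.
move=> /tw E1 /tw E2; have [tty it] := generic_twist gty lt E1 E2.
have := invy; rewrite -[y](mulKg t) -tty; rewrite -tty in it.
by have := invertsV it; rewrite invgK => iti /(_ iti) /(inverts_sq it).
Qed.

Definition sym_set A : Prop := uniq A /\ forall a, a \in A -> a^-1 \in A.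

(** [V] is what new labels must avoid; taking [V] to be [1 :: B] keeps fat and thin labels
    disjoint. *)
Definition extends V A A' : Prop :=
  [/\ sym_set A', {subset A <= A'} & forall a, a \in A' -> a \in A \/ a \notin V].

Lemma extends_trans V A1 A2 A3 : extends V A1 A2 -> extends V A2 A3 -> extends V A1 A3.
Proof.
move=> [s2 A12 V2] [s3 A23 V3]; split=> // [a /A12/A23 //|a /V3 [/V2|]]; last by right.
by case; [left|right].
Qed.

Lemma fat_count_cat A P y : uniq A -> uniq P -> (forall a, a \in A -> a \notin P) ->
  (forall a, a \in A -> a^-1 * y \notin P) -> (forall p, p \in P -> p^-1 * y \notin A) ->
  fat_count (A ++ P) y = fat_count A y + fat_count P y.
Proof.
move=> uA uP AP AyP PyA; rewrite /fat_count count_cat.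
congr addn; apply: eq_in_count => x xA; rewrite mem_cat.
  by rewrite (negPf (AyP _ xA)) orbF.
by rewrite (negPf (PyA _ xA)).
Qed.

Variables B V : seq H.
Hypotheses (BV : forall b, b \in B -> b^-1 \in B) (B1 : 1 \notin B)
  (Bgen : forall b c, b \in B -> c \in 1 :: B -> generic h (b * c) /\ generic h (c * b)).

Lemma add_quad A t : sym_set A -> t \in B -> exists A',
  [/\ extends V A A', fat_count A t < fat_count A' t &
      forall y, y \in B -> ~~ affects t y -> fat_count A' y = fat_count A y].
Proof.
move=> [uA AV] tB.
(* Besides [V] and [A], the quadruple avoids all [a^-1 * y] and [y * a^-1], so no label in [B]
   factors into one old and one new label and [fat_count] is additive. *)
pose V' := V ++ A ++ [seq a^-1 * y | a <- A, y <- B] ++ [seq y * a^-1 | a <- A, y <- B].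
have [N QN] := ev_and (ev_quad_mul BV B1 tB Bgen)
  (ev_all (s := V') (fun v _ => ev_quad_neq t v)).
have [qB qV] := QN N (leqnn _) => {QN}.
pose P := undup (quad t N).
have AP a : a \in A -> a \notin P by move=> aA; rewrite mem_undup qV // !mem_cat aA orbT.
have FE y : y \in B -> fat_count (A ++ P) y = fat_count A y + fat_count P y.
  move=> yB; apply: fat_count_cat => // [|a aA|p pP]; first exact: undup_uniq.
    rewrite mem_undup qV // !mem_cat [X in _ || (_ || (X || _))](_ : _ = true) ?orbT //.
    by apply/allpairsP; exists (a, y).
  apply/negP => pyA; have := qV (y * (p^-1 * y)^-1); rewrite !mem_cat.
  rewrite [X in _ || (_ || (_ || X))](_ : _ = true) ?orbT; last first.
    by apply/allpairsP; exists (p^-1 * y, y).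
  by rewrite invgM invgK mulVKg -(mem_undup (quad t N)) pP => /(_ isT).
exists (A ++ P); split=> [||y yB ny].
- split=> [|a aA|a]; last 2 first.
  + by rewrite mem_cat aA.
  + rewrite mem_cat => /orP[|aP]; first by left.
    by right; apply/negP => aV; have := qV a; rewrite !mem_cat aV -(mem_undup (quad t N)) aP => /(_ isT).
  split; first by rewrite cat_uniq uA undup_uniq andbT -all_predC; apply/allP => a /=; apply: contraL => /AP.
  move=> a; rewrite !mem_cat => /orP[/AV -> //|]; rewrite !mem_undup => /quadV ->.
  by rewrite orbT.
- rewrite FE // -[ltnLHS]addn0 ltn_add2l -has_count; apply/hasP; exists (h ^+ N).
    by rewrite mem_undup inE eqxx.
  by rewrite mem_undup !inE eqxx !orbT.
- rewrite FE // [X in (_ + X)%N](_ : _ = 0) ?addn0 //; apply/eqP.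
  rewrite -leqn0 leqNgt -has_count; apply: contra ny => /hasP[a].
  by rewrite !mem_undup; exact: qB.
Qed.

Lemma add_quads n A t : sym_set A -> t \in B -> exists A',
  [/\ extends V A A', n <= fat_count A' t &
      forall y, y \in B -> ~~ affects t y -> fat_count A' y = fat_count A y].
Proof.
move=> sA tB; elim: n => [|n [A1 [e1 n1 f1]]]; first by exists A; split=> //; split=> //; left.
have [s1 _ _] := e1; have [A2 [e2 n2 f2]] := add_quad s1 tB.
exists A2; split; first exact: extends_trans e1 e2.
  exact: leq_ltn_trans n2.
by move=> y yB ny; rewrite f2 // f1.
Qed.

(** The labels of [L] are handled one at a time, each receiving a count above all earlier ones. The
    hypothesis on [inverts] ensures that the earlier counts are unaffected. *)
Lemma separate L D A : sym_set A -> {subset L <= B} -> {subset D <= B} ->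
  (forall t, t \in L -> inverts h t -> forall x, x \in D ++ L -> inverts h x) ->
  separated A D -> exists A', extends V A A' /\ separated A' (D ++ L).
Proof.
elim: L D A => [|t L IHL] D A sA LB DB inv sep.
  by exists A; rewrite cats0; split=> //; split=> //; left.
have tB : t \in B by apply: LB; exact: mem_head.
suff [A1 [e1 sep1]] : exists A1, extends V A A1 /\ separated A1 (t :: D).
  have [s1 _ _] := e1; have mD x : (x \in (t :: D) ++ L) = (x \in D ++ t :: L).
    by rewrite !mem_cat !inE orbCA orbA.
  have [|||A2 [e2 sep2]] := IHL (t :: D) A1 s1 _ _ _ sep1.
  - by move=> x xL; apply: LB; rewrite inE xL orbT.
  - by move=> x; rewrite inE => /orP[/eqP -> //|]; exact: DB.
  - by move=> u uL iu x; rewrite mD; apply: inv iu _; rewrite inE uL orbT.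
  exists A2; split; first exact: extends_trans e1 e2.
  by move=> x y xD yD; apply: sep2; rewrite mD.
(* If [t] or [t^-1] has been handled already, [fat_countV] shows that nothing is to be added. *)
have [/hasP[d dD dt]|nt] := boolP (has (fun d => (d == t) || (d == t^-1)) D).
  exists A; split; first by split=> //; left.
  have [uA AV] := sA.
  have rep x : x \in t :: D -> exists x',
      [/\ x' \in D, fat_count A x' = fat_count A x & x' = x \/ x' = x^-1].
    rewrite inE => /orP[/eqP ->|xD]; last by exists x; split=> //; left.
    exists d; case/orP: dt => /eqP E; rewrite E in dD *; split=> //; rewrite ?fat_countV //.
      by left.
    by right.
  move=> x y /rep[x' [xD Fx xx']] /rep[y' [yD Fy yy']] Fxy.
  have := sep x' y' xD yD; rewrite Fx Fy => /(_ Fxy) => x'y'.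
  by case: xx' x'y' => -> [] E; case: yy' => E2; rewrite E2 in E;
     first [by left; rewrite -(invgK y) E ?invgK | by right; rewrite -(invgK y) E ?invgK].
(* One more than the sum of the earlier counts exceeds each of them. *)
have [A1 [e1 n1 f1]] := add_quads (\sum_(x <- D) fat_count A x).+1 sA tB.
have uD x : x \in D -> fat_count A1 x = fat_count A x /\ fat_count A x < fat_count A1 t.
  move=> xD; split.
    apply: f1; first exact: DB.
    rewrite /affects !negb_or negb_and negbK; apply/and3P; split.
    - by apply: contra nt => E; apply/hasP; exists x; rewrite ?E.
    - by apply: contra nt => E; apply/hasP; exists x; rewrite ?E ?orbT.
    - by rewrite -implybE; apply/implyP => it; apply: inv it _ _; rewrite ?mem_head ?mem_cat ?xD.
  apply: leq_trans n1; rewrite ltnS (big_rem x xD) /=; exact: leq_addr.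
exists A1; split=> // x y; rewrite !inE => /orP[/eqP ->|xD] /orP[/eqP ->|yD].
- by left.
- by have [-> lt] := uD y yD => E; rewrite E ltnn in lt.
- by have [-> lt] := uD x xD => E; rewrite E ltnn in lt.
- have [-> _] := uD x xD; have [-> _] := uD y yD; exact: sep.
Qed.

Lemma separating_extension A : sym_set A -> exists A', extends V A A' /\ separated A' B.
Proof.
move=> sA; pose L b := [seq t <- B | inverts h t == b].
have LB b : {subset L b <= B} by move=> t; rewrite mem_filter => /andP[].
have Li b t : t \in L b -> inverts h t = b by rewrite mem_filter => /andP[/eqP].
have sep0 : separated A [::] by [].
have [//||A1 [e1 sep1]] := separate sA (LB true) _ _ sep0.
  by move=> t _ _ x /Li.
have [s1 _ _] := e1.
have [|A2 [e2 sep2]] := @separate (L false) (L true) A1 s1 (LB _) (LB _) _ sep1.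
- by move=> t /Li ->.
exists A2; split; first exact: extends_trans e1 e2.
move=> x y xB yB; apply: sep2; rewrite mem_cat !mem_filter ?xB ?yB !andbT.
  by case: (inverts h x).
by case: (inverts h y).
Qed.

End Generic.

(** If [v = g ^+ (M * k)], all positive multiples of [M * (2 * k)] exceed [M * k], so passing to
    them avoids [v]. *)
Lemma power_avoiding g V : has_infinite_order g ->
  exists2 M : nat, 0 < M & forall k, 0 < k -> g ^+ (M * k) \notin V.
Proof.
move=> ginf; have gI := inf_order_inj ginf.
elim: V => [|v V [M M0 IHV]]; first by exists 1%N.
have [[k k0 Ek]|nk] := pselect (exists2 k, 0 < k & g ^+ (M * k) = v); last first.
  exists M => // k k0; rewrite inE negb_or IHV // andbT.
  by apply/eqP => E; apply: nk; exists k.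
exists (M * (2 * k))%N => [|j j0]; first by rewrite !muln_gt0 M0 k0.
rewrite inE negb_or -mulnA IHV ?muln_gt0 ?k0 // andbT -Ek.
by apply/eqP => /gI /eqP; rewrite eqn_mul2l -[X in _ == X]muln1; nia.
Qed.

(** * Odd and even powers of an element of infinite order *)

Section OddPowers.
Variable h : H.
Hypothesis hinf : has_infinite_order h.

Definition parity_power (b : bool) x : Prop :=
  exists2 k, odd k = b & x = h ^+ k \/ x = h ^- k.

Lemma odd_power_mul x y : parity_power true x -> parity_power true y ->
  parity_power false (x * y).
Proof.
move=> [m om xm] [n on yn].
have sub (k l : nat) : odd k -> odd l -> parity_power false (h ^+ k * h ^- l).
  move=> ok ol; have [lk|/ltnW kl] := leqP l k.
    exists (k - l)%N; first by rewrite oddB // ok ol.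
    by left; rewrite expgnFr.
  exists (l - k)%N; first by rewrite oddB // ok ol.
  by right; rewrite expgnFr // invgF.
case: xm yn => -> [] ->.
- by exists (m + n)%N; [rewrite oddD om on | left; rewrite expgnDr].
- exact: sub.
- by rewrite -(commuteV (commuteX2 n m (commute_refl h))); exact: sub.
- by exists (n + m)%N; [rewrite oddD om on | right; rewrite expgnDr invgM].
Qed.

Lemma parity_power_contra x : parity_power true x -> parity_power false x -> False.
Proof.
have hI := inf_order_inj hinf.
have no k l : odd k -> ~~ odd l -> h ^+ k = h ^- l -> False.
  move=> ok ol /(congr1 (fun w => w * h ^+ l)); rewrite mulVg -expgnDr; apply: hinf.
  by case: k ok.
have no' k l : odd k -> odd l = false -> h ^+ k = h ^+ l -> False.
  by move=> ok ol /hI E; rewrite E ol in ok.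
move=> [k ok [|] ->] [l ol [|]].
- exact: no'.
- by apply: no; rewrite ?ol.
- by move=> E; apply: (no k l); rewrite ?ol // -E invgK.
- by move/invg_inj; exact: no'.
Qed.

End OddPowers.

(* The last condition makes the edges labelled by the central element
   recognizable.  It is achieved by adding many odd powers of an element of
   infinite order, because a product of two odd powers is an even one. *)
Lemma fat_set_exists g (B U : seq H) : has_infinite_order g ->
  (forall b, b \in B -> b^-1 \in B) -> 1 \notin B -> exists A,
  [/\ sym_set A, forall a, a \in A -> a \notin 1 :: B,
      forall u, u \in U -> u \in 1 :: A ++ B, separated A B &
      forall w, w \in A ++ B ->
        2 * count (fun k => k^-1 * w \in 1 :: A ++ B) (undup (1 :: A ++ B)) < size A].
Proof.
move=> ginf BV B1.
pose gs := [seq b * c | b <- B, c <- 1 :: B] ++ [seq c * b | b <- B, c <- 1 :: B].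
have [M M0 gen] := exists_generic g gs.
have hinf : has_infinite_order (g ^+ M).
  by move=> n n0; rewrite -expgnA; apply: ginf; rewrite muln_gt0 M0.
have Bgen b c : b \in B -> c \in 1 :: B ->
    generic (g ^+ M) (b * c) /\ generic (g ^+ M) (c * b).
  by move=> bB cB; split; apply: gen; rewrite mem_cat; apply/orP; [left|right];
     apply/allpairsP; exists (b, c).
(* The elements of [U] not in [1 :: B] become fat labels, together with their inverses. *)
pose A0 := undup [seq u <- U ++ [seq u^-1 | u <- U] | u \notin 1 :: B].
have sA0 : sym_set A0.
  split=> [|a]; first exact: undup_uniq.
  rewrite !mem_undup !mem_filter !mem_cat => /andP[aB aU]; apply/andP; split.
    apply: contra aB; rewrite !inE invg_eq1 => /orP[-> //|/BV].
    by rewrite invgK => ->; rewrite orbT.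
  case/orP: aU => [aU|/mapP[u uU ->]]; last by rewrite invgK uU.
  by rewrite [X in _ || X](_ : _ = true) ?orbT //; apply/mapP; exists a.
have [A1 [[[uA1 A1V] A01 A1B] sep]] :=
  separating_extension hinf (1 :: B) BV B1 Bgen sA0.
have A1nB a : a \in A1 -> a \notin 1 :: B.
  by move=> /A1B[|//]; rewrite mem_undup mem_filter => /andP[].
(* [n] exceeds [4 * size W], the bound needed for the last condition. The odd powers will avoid [V],
   whose quotients exclude mixed factorizations of labels in [B]. *)
pose W := 1 :: A1 ++ B; pose n := (2 * size W).+1.*2.
pose V := W ++ [seq a^-1 * y | a <- A1, y <- B] ++ [seq y * a^-1 | a <- A1, y <- B].
have [E E0 hV] := power_avoiding (V ++ [seq v^-1 | v <- V]) hinf.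
set h := g ^+ M in hV hinf; pose h1 := h ^+ E.
have h1inf : has_infinite_order h1.
  by move=> k k0; rewrite /h1 -expgnA; apply: hinf; rewrite muln_gt0 E0.
have h1V k : 0 < k -> h1 ^+ k \notin V /\ h1 ^- k \notin V.
  move=> k0; have := hV k k0; rewrite mem_cat negb_or expgnA => /andP[h1V h1VV].
  split=> //; apply: contra h1VV => h1V'; apply/mapP; exists (h1 ^- k) => //.
  by rewrite invgK.
pose A2p := [seq h1 ^+ j.*2.+1 | j <- iota 0 n].
pose A2 := undup (A2p ++ [seq a^-1 | a <- A2p]).
have uA2 : uniq A2 by exact: undup_uniq.
have A2odd a : a \in A2 -> parity_power h1 true a.
  have A2po b : b \in A2p -> exists2 k, odd k & b = h1 ^+ k.
    by move=> /mapP[j _ ->]; exists j.*2.+1; rewrite //= odd_double.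
  rewrite mem_undup mem_cat => /orP[/A2po[k ok ->]|/mapP[b /A2po[k ok ->] ->]].
    by exists k => //; left.
  by exists k => //; right.
have A2V a : a \in A2 -> a^-1 \in A2.
  rewrite !mem_undup !mem_cat => /orP[aA|/mapP[b bA ->]]; last by rewrite invgK bA.
  by apply/orP; right; apply/mapP; exists a.
have A2nV a : a \in A2 -> a \notin V.
  by move=> /A2odd[k ok [] ->]; have [] : _ := h1V k _; case: k ok.
have A2mul a b : a \in A2 -> b \in A2 -> a * b = 1 \/ a * b \notin V ++ A2.
  move=> /A2odd oa /A2odd ob; have ev := odd_power_mul oa ob.
  have [k ek abk] := ev; rewrite mem_cat.
  have [ab2|ab2] := boolP (a * b \in A2).
    by case: (parity_power_contra h1inf (A2odd _ ab2) ev).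
  rewrite orbF; have [k0|k0] := posnP k; first by left; case: abk => ->; rewrite k0 ?invg1.
  by right; have [? ?] := h1V k k0; case: abk => ->.
have nA2 : n <= size A2.
  rewrite -[n](size_iota 0) -(size_map (fun j => h1 ^+ j.*2.+1)); apply: uniq_leq_size.
    rewrite map_inj_uniq ?iota_uniq // => i j E1.
    by have := inf_order_inj h1inf E1; lia.
  by move=> a aA; rewrite mem_undup mem_cat aA.
have A12 a : a \in A1 -> a \notin A2.
  by apply: contraTN => /A2nV; apply: contra => aA; rewrite !mem_cat inE mem_cat aA orbT.
have FE y : y \in B -> fat_count (A1 ++ A2) y = fat_count A1 y.
  move=> yB; rewrite fat_count_cat //.
  - rewrite [X in (_ + X)%N](_ : _ = 0) ?addn0 //; apply/eqP.
    rewrite -leqn0 leqNgt -has_count; apply/hasPn => a aA2; apply/negP => ayA2.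
    have [|] := A2mul _ _ aA2 ayA2; rewrite mulVKg => E1; first by rewrite -E1 yB in B1.
    by move/negP: E1; apply; rewrite !mem_cat inE mem_cat yB !orbT.
  - move=> a aA; apply/negP => /A2nV /negP; apply; rewrite !mem_cat.
    by rewrite [X in _ || (X || _)](_ : _ = true) ?orbT //; apply/allpairsP; exists (a, y).
  - move=> p pA2; apply/negP => pyA; move/negP: (A2nV p pA2); apply; rewrite !mem_cat.
    rewrite [X in _ || (_ || X)](_ : _ = true) ?orbT //.
    by apply/allpairsP; exists (p^-1 * y, y); split=> //; rewrite invgM invgK mulVKg.
exists (A1 ++ A2); split.
- split=> [|a].
    rewrite cat_uniq uA1 uA2 andbT -all_predC; apply/allP => a /=.
    by apply: contraL => /A12.
  by rewrite !mem_cat => /orP[/A1V ->|/A2V ->]; rewrite ?orbT.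
- move=> a; rewrite mem_cat => /orP[/A1nB //|/A2nV]; apply: contra.
  by rewrite !mem_cat !inE mem_cat => /orP[->|->]; rewrite ?orbT.
- move=> u uU; have [uB|uB] := boolP (u \in 1 :: B).
    by move: uB; rewrite !inE !mem_cat => /orP[->|->]; rewrite ?orbT.
  rewrite inE !mem_cat (A01 u) ?orbT // mem_undup mem_filter uB mem_cat uU.
  by [].
- by move=> x y xB yB; rewrite !FE //; exact: sep.
(* If neither [k] nor [k^-1 * w] is in [W], both are odd powers, so [w] is [1] or outside [V ++ A2],
   which is impossible. Hence the count is at most [2 * size W]. *)
- move=> w wAB.
  have split_W x : x \in 1 :: (A1 ++ A2) ++ B -> x \in W \/ x \in A2.
    rewrite inE !mem_cat [x \in W]inE mem_cat => /orP[->|/orP[/orP[->|->]|->]];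
      rewrite ?orbT; by [left|right].
  apply: (@leq_ltn_trans (2 * (size W + size W))); last first.
    by rewrite size_cat; apply: leq_trans (leq_addl _ _); apply: leq_trans nA2; rewrite /n; lia.
  rewrite leq_mul2l; apply/orP; right; set s := undup _.
  have us : uniq s by exact: undup_uniq.
  apply: leq_trans (leq_add (count_mem_le W (@inj_id _) us)
    (count_mem_le (f := fun k => k^-1 * w) W _ us)); last by move=> x y /mulIg/invg_inj.
  rewrite -count_predUI; apply: leq_trans (leq_addr _ _).
  rewrite -!size_filter; apply: uniq_leq_size; first exact: filter_uniq.
  move=> x; rewrite !mem_filter /= => /andP[xw xs]; rewrite xs andbT.
  have xm : x \in 1 :: (A1 ++ A2) ++ B by move: xs; rewrite /s mem_undup.
  have [-> //|xA2] := split_W x xm.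
  have [->|xwA2] := split_W _ xw; first by rewrite orbT.
  have := A2mul _ _ xA2 xwA2; rewrite mulVKg => -[w1|].
    move: wAB; rewrite w1 !mem_cat (negPf B1) orbF => /orP[/A1nB|/A2nV].
      by rewrite inE eqxx.
    by rewrite !mem_cat inE eqxx.
  move: wAB; rewrite !mem_cat inE mem_cat.
  by case/orP => [/orP[]|] ->; rewrite ?orbT.
Qed.

End FatSet.

(** * Recognition of the labels by a covering *)

Lemma Z2_cases (e : 'Z_2) : e = 0%R \/ e = 1%R.
Proof. by case: e => [[|[|m]] lm]; [left|right|]; do ?exact: val_inj. Qed.

Lemma Z2_addK (e f : 'Z_2) : (e + f + f = e)%R.
Proof. by case: (Z2_cases e) => ->; case: (Z2_cases f) => ->; apply/val_inj. Qed.

Lemma Z2_oppr (e : 'Z_2) : (- e = e)%R.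
Proof. by case: (Z2_cases e) => ->; apply/val_inj. Qed.

Lemma Z2_exchange (a b d e : 'Z_2) : (a + b = d + e -> b + e = d + a)%R.
Proof.
by case: (Z2_cases a) => ->; case: (Z2_cases b) => ->; case: (Z2_cases d) => ->;
   case: (Z2_cases e) => ->; move/eqP => E; apply/eqP; move: E; vm_compute.
Qed.

Lemma sum_le_eq (T : eqType) (s : seq T) (F G : T -> nat) :
  (forall x, x \in s -> F x <= G x) -> \sum_(x <- s) F x = \sum_(x <- s) G x ->
  forall x, x \in s -> F x = G x.
Proof.
move=> FG; elim: s FG => [//|y s IHs] FG; rewrite !big_cons => E.
have Fy := FG y (mem_head _ _).
have Fs : \sum_(x <- s) F x <= \sum_(x <- s) G x.
  by rewrite big_seq [leqRHS]big_seq; apply: leq_sum => x xs; rewrite FG // inE xs orbT.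
have [Ey Es] : F y = G y /\ \sum_(x <- s) F x = \sum_(x <- s) G x by lia.
move=> x; rewrite inE => /orP[/eqP -> //|xs].
by apply: IHs => // z zs; rewrite FG // inE zs orbT.
Qed.

Section Twisting.
Local Open Scope group_scope.
Variables (H Ht : groupType) (pi : Ht -> H) (zeta : 'Z_2 -> Ht)
  (lift : H -> Ht) (A B : seq H) (sg : H -> Ht).

Definition central_ext : Prop :=
  {morph pi : x y / x * y} /\
  [/\ {morph zeta : e f / (e + f)%R >-> e * f}, injective zeta,
      forall x, pi x = 1 <-> exists e, x = zeta e,
      forall e x, zeta e * x = x * zeta e & cancel lift pi].

Definition twisted_adj (c : H -> H -> 'Z_2) (x y : Ht) : Prop :=
  let k := x^-1 * y in
  [\/ k = zeta 1%R, pi k \in A |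
      pi k \in B /\ k = sg (pi k) * zeta (c (pi x) (pi k))].

Hypothesis ext : central_ext.

Lemma piM x y : pi (x * y) = pi x * pi y.
Proof. by case: ext. Qed.

Lemma pi1 : pi 1 = 1.
Proof. by apply: (mulgI (pi 1)); rewrite -piM !mulg1. Qed.

Lemma piV x : pi x^-1 = (pi x)^-1.
Proof. by apply: (mulgI (pi x)); rewrite -piM !mulgV pi1. Qed.

Lemma zetaD e f : zeta (e + f)%R = zeta e * zeta f.
Proof. by case: ext => _ []. Qed.

Lemma zeta_inj : injective zeta.
Proof. by case: ext => _ []. Qed.

Lemma pi_zeta e : pi (zeta e) = 1.
Proof. by case: ext => _ [_ _ ker _ _]; apply/ker; exists e. Qed.

Lemma zetaC e x : zeta e * x = x * zeta e.
Proof. by case: ext => _ []. Qed.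

Lemma pi_liftK : cancel lift pi.
Proof. by case: ext => _ []. Qed.

Lemma zeta0 : zeta 0%R = 1.
Proof. by apply: (mulgI (zeta 0%R)); rewrite -zetaD mulg1 addr0. Qed.

Lemma zetaK e : zeta e * zeta e = 1.
Proof. by rewrite -zetaD -zeta0; congr zeta; rewrite -[LHS]add0r addrA Z2_addK. Qed.

Lemma zetaV e : (zeta e)^-1 = zeta e.
Proof. by apply: (mulgI (zeta e)); rewrite mulgV zetaK. Qed.

Lemma pi_mul_zeta x e : pi (x * zeta e) = pi x.
Proof. by rewrite piM pi_zeta mulg1. Qed.

Lemma pi_fiber x y : pi x = pi y -> exists e, y = x * zeta e.
Proof.
move=> xy; have [_ [_ _ ker _ _]] := ext.
have [|e E] := (ker (x^-1 * y)).1; first by rewrite piM piV xy mulVg.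
by exists e; rewrite -E mulVKg.
Qed.

Section Recognition.
Hypotheses (sA : sym_set A) (AB : forall a, a \in A -> a \notin 1 :: B)
  (B1 : 1 \notin B) (sep : separated A B)
  (few : forall w, w \in A ++ B ->
    2 * count (fun k => k^-1 * w \in 1 :: A ++ B) (undup (1 :: A ++ B)) < size A)
  (sgK : forall b, b \in B -> pi (sg b) = b).
Variables (c : H -> H -> 'Z_2) (q : Ht -> Ht).
Hypotheses
  (qadj : forall x y, twisted_adj (fun _ _ => 0%R) x y -> twisted_adj c (q x) (q y))
  (qinj : forall x y z, twisted_adj (fun _ _ => 0%R) x y ->
    twisted_adj (fun _ _ => 0%R) x z -> q y = q z -> y = z).

Let adj0 := twisted_adj (fun _ _ => 0%R).

Lemma twisted_adj_label d x y : twisted_adj d x y -> pi (x^-1 * y) \in 1 :: A ++ B.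
Proof.
rewrite inE mem_cat; case=> [->|->|[-> _]]; rewrite ?orbT //.
by rewrite pi_zeta eqxx.
Qed.

Let adj0_zeta x : adj0 x (x * zeta 1%R).
Proof. by constructor 1; rewrite mulKg. Qed.

Let adj0_fat x k : pi k \in A -> adj0 x (x * k).
Proof. by constructor 2; rewrite mulKg. Qed.

Let adj0_thin x b : b \in B -> adj0 x (x * sg b).
Proof. by move=> bB; constructor 3; rewrite mulKg zeta0 mulg1 sgK. Qed.

(* The edge from [x] to [x * zeta 1] lies in [size A] triangles with distinct
   images, too many for an edge of the target which is not vertical. *)
Lemma covering_zeta1 x : q (x * zeta 1%R) = q x * zeta 1%R.
Proof.
have [uA AV] := sA.
set y := q x; set y' := q _; have yy' : twisted_adj c y y' by apply/qadj/adj0_zeta.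
have [E|nE] := pselect (y^-1 * y' = zeta 1%R); first by rewrite -E mulVKg.
set w := pi (y^-1 * y').
have wAB : w \in A ++ B.
  by case: yy' => [//|wA|[wB _]]; rewrite mem_cat /w ?wA ?wB ?orbT.
(* Third vertices of triangles on the target edge have labels in [C], with two lifts each. On the
   source edge every [x * lift a] is a third vertex, with two fat sides. *)
pose C := [seq k <- undup (1 :: A ++ B) | k^-1 * w \in 1 :: A ++ B].
pose L := [seq y * lift k * zeta e | k <- C, e <- [:: 0%R; 1%R]].
have := few wAB; rewrite -size_filter -/C ltnNge => /negP[].
have <- : size L = (2 * size C)%N by rewrite size_allpairs mulnC.
rewrite -(size_map (fun a => q (x * lift a))); apply: uniq_leq_size.
  rewrite map_inj_in_uniq // => a b aA bA /qinj E.
  rewrite -[a]pi_liftK -[b]pi_liftK; congr (pi _); apply: (mulgI x).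
  by apply: E; apply: adj0_fat; rewrite pi_liftK.
move=> _ /mapP[a aA ->]; set u := q _.
have yu : twisted_adj c y u by apply/qadj/adj0_fat; rewrite pi_liftK.
have uy' : twisted_adj c u y'.
  apply: qadj; constructor 2; rewrite invgM -mulgA mulKg piM piV pi_liftK pi_zeta mulg1.
  exact: AV.
set k := pi (y^-1 * u); have kC : k \in C.
  rewrite mem_filter mem_undup (twisted_adj_label yu) andbT.
  by have := twisted_adj_label uy'; rewrite /k /w -piV -piM; gsimp.
have [e E] : exists e, y^-1 * u = lift k * zeta e by apply: pi_fiber; rewrite pi_liftK.
apply/allpairsP; exists (k, e); split=> //=.
  by case: (Z2_cases e) => ->; rewrite !inE eqxx ?orbT.
by rewrite -mulgA -E mulVKg.
Qed.

Lemma covering_zeta x e : q (x * zeta e) = q x * zeta e.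
Proof.
by case: (Z2_cases e) => ->; rewrite ?covering_zeta1 // zeta0 !mulg1.
Qed.

(** The map induced on [H]; it does not depend on the choice of [lift] because [q] commutes with
    [zeta] ([base_mapE]). *)
Definition base_map h : H := pi (q (lift h)).

Lemma base_mapE x : pi (q x) = base_map (pi x).
Proof.
have [e E] : exists e, lift (pi x) = x * zeta e by apply: pi_fiber; rewrite pi_liftK.
by rewrite /base_map E covering_zeta pi_mul_zeta.
Qed.

Definition label_map h s : H := (base_map h)^-1 * base_map (h * s).

Lemma label_mapE h s : base_map (h * s) = base_map h * label_map h s.
Proof. by rewrite mulVKg. Qed.

Lemma label_map_pi x k : pi ((q x)^-1 * q (x * k)) = label_map (pi x) (pi k).
Proof. by rewrite piM piV !base_mapE piM. Qed.

Let pi_eq_inj x y z : adj0 x y -> (forall e, adj0 x (z * zeta e)) ->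
  pi (q y) = pi (q z) -> pi y = pi z.
Proof.
move=> xy xz /esym/pi_fiber[e]; rewrite -covering_zeta => /(qinj xy (xz e)) ->.
by rewrite pi_mul_zeta.
Qed.

Let adj0_fat_zeta x a e : a \in A -> adj0 x (x * lift a * zeta e).
Proof. by move=> aA; rewrite -mulgA; apply: adj0_fat; rewrite pi_mul_zeta pi_liftK. Qed.

Let fat_inj x y a : a \in A -> adj0 x y -> pi (q y) = base_map (pi x * a) -> pi y = pi x * a.
Proof.
move=> aA xy E; have -> : pi x * a = pi (x * lift a) by rewrite piM pi_liftK.
apply: pi_eq_inj xy _ _ => [e|]; first exact: adj0_fat_zeta.
by rewrite E base_mapE piM pi_liftK.
Qed.

(** Both lifts of a fat label give edges, but only one lift of a thin label does. As [q] commutes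
    with [zeta], a fat edge cannot become thin; local injectivity keeps it from becoming
    vertical. *)
Lemma label_map_fat h a : a \in A -> label_map h a \in A.
Proof.
move=> aA; pose x := lift h; pose k := lift a.
have aB := AB aA; have kA : pi k \in A by rewrite pi_liftK.
rewrite -[h]pi_liftK -[a]pi_liftK -label_map_pi.
have := qadj (adj0_fat x kA); set w := (q x)^-1 * _; case=> [E| //|[wB E]].
  case/negP: aB; rewrite inE -[a]pi_liftK; apply/orP; left; apply/eqP.
  rewrite -[RHS](pi_zeta 1%R); congr (pi _); apply: (mulgI x).
  apply: qinj (adj0_fat x kA) (adj0_zeta x) _.
  by rewrite covering_zeta1 -E mulVKg.
have kA' : pi (k * zeta 1%R) \in A by rewrite pi_mul_zeta.
have wE : (q x)^-1 * q (x * (k * zeta 1%R)) = w * zeta 1%R.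
  by rewrite mulgA covering_zeta1 mulgA.
have := qadj (adj0_fat x kA'); rewrite /twisted_adj wE pi_mul_zeta; case=> [E2|//|[_ E2]].
  case/negP: B1; rewrite -(_ : pi w = 1) //.
  by apply/eqP; rewrite -[w](mulgK (zeta 1%R)) E2 mulgV pi1.
have := congr1 (fun u => w^-1 * u) E2; rewrite -E mulKg mulVg -zeta0 => /zeta_inj.
by [].
Qed.

Lemma label_map_fat_inj h a b : a \in A -> b \in A -> label_map h a = label_map h b -> a = b.
Proof.
move=> aA bA /mulgI E; apply: (mulgI h); rewrite -[h]pi_liftK -[b]pi_liftK -piM.
apply/esym/fat_inj => //; last by rewrite base_mapE piM !pi_liftK.
by apply: adj0_fat; rewrite pi_liftK.
Qed.

Lemma label_map_fat_surj h a : a \in A -> exists2 b, b \in A & label_map h b = a.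
Proof.
have [uA _] := sA; move=> aA.
have um : uniq [seq label_map h b | b <- A].
  by rewrite map_inj_in_uniq // => x y xA yA; exact: label_map_fat_inj.
have sub : {subset [seq label_map h b | b <- A] <= A}.
  by move=> _ /mapP[b bA ->]; exact: label_map_fat.
have [_ E] := uniq_min_size um sub (eq_leq (esym (size_map _ _))).
by move: aA; rewrite -E => /mapP[b bA ->]; exists b.
Qed.

(** All fat labels at the image vertex are already taken by images of fat edges, so by local
    injectivity none is left for a thin edge. *)
Lemma label_map_thin h b : b \in B -> label_map h b \in B.
Proof.
move=> bB; pose x := lift h.
rewrite -[h]pi_liftK -[b]sgK // -label_map_pi; have xb := adj0_thin x bB.
have := qadj xb; set w := (q x)^-1 * _; case=> [E|wA|[wB _] //].
  case/negP: B1; rewrite -(_ : b = 1) // -[b]sgK // -(pi_zeta 1%R).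
  congr (pi _); apply: (mulgI x); apply: qinj xb (adj0_zeta x) _.
  by rewrite covering_zeta1 -E mulVKg.
have [a aA E] := label_map_fat_surj h wA.
have := fat_inj aA xb _; rewrite pi_liftK piM sgK // pi_liftK => /(_ _)/mulgI ab.
have := AB aA; rewrite -ab ?inE ?bB ?orbT //.
by rewrite label_mapE E /w piM piV /base_map mulVKg.
Qed.

Lemma thin_edge x b : b \in B ->
  q (x * sg b) = q x * sg (label_map (pi x) b)
                     * zeta (c (base_map (pi x)) (label_map (pi x) b)).
Proof.
move=> bB; have wB := label_map_thin (pi x) bB.
have wE := label_map_pi x (sg b); rewrite sgK // in wE; rewrite -wE in wB *.
have := qadj (adj0_thin x bB); case=> [E|wA|[_ E]].
- by case/negP: B1; move: wB; rewrite E pi_zeta.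
- by have := AB wA; rewrite inE wB orbT.
- by rewrite -base_mapE -mulgA -E mulVKg.
Qed.

Lemma label_map_thin_inj h b b' : b \in B -> b' \in B ->
  label_map h b = label_map h b' -> b = b'.
Proof.
move=> bB b'B E; rewrite -[b]sgK // -[b']sgK //; congr (pi _).
apply: (mulgI (lift h)); apply: qinj (adj0_thin _ bB) (adj0_thin _ b'B) _.
by rewrite !thin_edge // pi_liftK E.
Qed.

(** The factorization of [b] into [a] and [a^-1 * b] goes to the factorization of the image label
    into [label_map h a] and [label_map (h * a) (a^-1 * b)], injectively in [a]. *)
Lemma fat_count_label h b : b \in B -> fat_count A b <= fat_count A (label_map h b).
Proof.
move=> bB; have [uA _] := sA.
rewrite /fat_count -!size_filter -(size_map (label_map h)); apply: uniq_leq_size.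
  rewrite map_inj_in_uniq ?filter_uniq // => x y; rewrite !mem_filter => /andP[_ xA] /andP[_ yA].
  exact: label_map_fat_inj.
move=> d /mapP[a]; rewrite !mem_filter => /andP[abA aA] ->; rewrite label_map_fat // andbT.
have := label_map_fat (h * a) abA; rewrite /label_map; gsimp.
by [].
Qed.

(* [label_map h] permutes [B] and cannot decrease [fat_count A], so it preserves
   it. *)
Lemma label_map_sign h b : b \in B -> label_map h b = b \/ label_map h b = b^-1.
Proof.
move=> bB; have lB := label_map_thin h bB; apply: sep => //.
have bU : b \in undup B by rewrite mem_undup.
apply: (sum_le_eq (F := fat_count A) (G := fun d => fat_count A (label_map h d)) _ _ bU) => [d|]; first by rewrite mem_undup; exact: fat_count_label.
rewrite -(big_map (label_map h) predT (fat_count A)); apply: perm_big.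
have um : uniq [seq label_map h d | d <- undup B].
  rewrite map_inj_in_uniq ?undup_uniq // => d e; rewrite !mem_undup.
  exact: label_map_thin_inj.
rewrite uniq_perm ?undup_uniq //.
have sub : {subset [seq label_map h d | d <- undup B] <= undup B}.
  by move=> _ /mapP[d + ->]; rewrite !mem_undup; exact: label_map_thin.
have [_ E] := uniq_min_size um sub (eq_leq (esym (size_map _ _))).
by move=> d; rewrite E.
Qed.

End Recognition.
End Twisting.

(** * Cocycles *)

Section Cocycles.
Variable G : groupType.
Local Open Scope ring_scope.
Implicit Types (f : G -> G -> 'Z_2) (g h k : G).

Definition cohomologous f f' : Prop :=
  exists u : G -> 'Z_2, forall g h, f' g h = f g h + coboundary1 u g h.

Lemma cocycle2B f f' : cocycle2 f -> cocycle2 f' ->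
  cocycle2 (fun g h => f g h - f' g h).
Proof.
move=> cf cf' g h k; move: (cf g h k) (cf' g h k).
set a := f h k; set b := f _ k; set d := f g _; set e := f g h.
set a' := f' h k; set b' := f' _ k; set d' := f' g _; set e' := f' g h => E E'.
have -> : a - a' - (b - b') + (d - d') - (e - e') = (a - b + d - e) - (a' - b' + d' - e').
  by ring.
by rewrite E E' subrr.
Qed.

Lemma coset_coboundary_eq f f' : cohomologous f f' ->
  coset_coboundary f = coset_coboundary f'.
Proof.
move=> [u fu]; apply/seteqP; split=> e [v ev].
  exists (fun g => v g - u g) => g h; rewrite ev fu /coboundary1; ring.
exists (fun g => v g + u g) => g h; rewrite ev fu /coboundary1; ring.
Qed.

Lemma cocycle2_right1 f g : cocycle2 f -> f g 1%g = f 1%g 1%g.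
Proof.
move=> cf; have := cf g 1%g 1%g; rewrite !mulg1.
by move=> E; apply/eqP; rewrite eq_sym -subr_eq0 -E; apply/eqP; ring.
Qed.

(* The last hypothesis says that, as a 1-cochain on the Cayley graph, [f] is
   the coboundary of [v]. *)
Lemma cohomologous_of_cochain (X : seq G) f f' v : cocycle2 f -> cocycle2 f' ->
  (forall g, exists n, g \in wball X n) ->
  (forall g x, x \in X -> f' g x - f g x = v (g * x)%g - v g) ->
  cohomologous f f'.
Proof.
move=> cf cf' genX fv.
have cd := cocycle2B cf' cf; set d := (fun g h => _) in cd.
pose e g h := d g h + coboundary1 v g h.
have ex g x : x \in X -> e g x = v x.
  by move=> xX; rewrite /e /d fv // /coboundary1; ring.
have ce : cocycle2 e.
  move=> g h k; rewrite -[RHS](cd g h k) /e /coboundary1 !mulgA; ring.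
(* On a generator, [e g x] does not depend on [g], so the cocycle identity reduces to
   [e g (k * x) = e g k]; induction on the word length makes [e] constant. *)
have e1 g h : e g h = e 1%g 1%g.
  have [n hn] := genX h; elim: n h hn g => [|n IHn] h.
    by rewrite inE => /eqP -> g; exact: cocycle2_right1.
  case/allpairsP=> -[k x] /= [kn xX ->] g.
  rewrite -(IHn k kn g); apply/eqP; rewrite -subr_eq0 -(ce g k x) !(ex _ _ xX).
  by apply/eqP; ring.
(* A constant 2-cochain is the coboundary of the constant 1-cochain with the same value. *)
pose u g := e 1%g 1%g - v g. exists u => g h.
have -> : f' g h = f g h + d g h by rewrite /d; ring.
have -> : d g h = e g h - coboundary1 v g h by rewrite /e; ring.
by rewrite e1 /coboundary1 /u; ring.
Qed.

(** There are finitely many restrictions to [L]. Subtracting a fixed representative with the same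
    restriction makes a cocycle vanish on [L], and classes sharing a restriction are all shifted by
    the same class. Then the pigeonhole principle applies to [d]. *)
Lemma infinite_H2_pigeonhole (L : seq (G * G)) (D : finType) (d : (G -> G -> 'Z_2) -> D) :
  infinite_set (@H2 G) -> exists f f',
  [/\ cocycle2 f /\ cocycle2 f',
      forall p, p \in L -> f p.1 p.2 = 0 /\ f' p.1 p.2 = 0,
      d f = d f' & ~ cohomologous f f'].
Proof.
move=> infH; apply: contrapT => none; apply: infH.
have [r rP] : exists r : set (G -> G -> 'Z_2) -> G -> G -> 'Z_2,
    forall C, H2 C -> cocycle2 (r C) /\ coset_coboundary (r C) = C.
  have /choice[r rP] : forall C, exists f : G -> G -> 'Z_2, H2 C -> cocycle2 f /\ coset_coboundary f = C.
    move=> C; have [[f cf fC]|nC] := pselect (H2 C); first by exists f.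
    by exists (fun _ _ => 0).
  by exists r.
pose D1 := {ffun 'I_(size L) -> 'Z_2}.
pose d1 C : D1 := [ffun i => r C (tnth (in_tuple L) i).1 (tnth (in_tuple L) i).2].
have [b bP] : exists b : D1 -> set (G -> G -> 'Z_2),
    forall C, H2 C -> H2 (b (d1 C)) /\ d1 (b (d1 C)) = d1 C.
  have /choice[b bP] : forall t : D1, exists B, (exists2 C, H2 C & d1 C = t) -> H2 B /\ d1 B = t.
    move=> t; have [[C HC Ct]|nC] := pselect (exists2 C, H2 C & d1 C = t); first by exists C.
    by exists set0.
  by exists b => C HC; apply: bP; exists C.
pose e C g h := r C g h - r (b (d1 C)) g h.
have ce C : H2 C -> cocycle2 (e C).
  by move=> HC; apply: cocycle2B; apply rP; first exact: HC; apply: (bP _ HC).1.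
have eL C p : H2 C -> p \in L -> e C p.1 p.2 = 0.
  move=> HC pL; have /tnthP[i ->] : p \in in_tuple L by []. apply/eqP; rewrite subr_eq0; apply/eqP.
  by have /ffunP/(_ i) := (bP _ HC).2; rewrite !ffunE.
pose dd C := (d1 C, d (e C)).
have ddI C C' : H2 C -> H2 C' -> dd C = dd C' -> C = C'.
  move=> HC HC' [d1C deC]; rewrite -(rP C HC).2 -(rP C' HC').2.
  apply: coset_coboundary_eq; apply: contrapT => nCC; apply: none.
  exists (e C), (e C'); split=> //; first by split; exact: ce.
    by move=> p pL; split; exact: eL.
  move=> [u eu]; apply: nCC; exists u => g h.
  by have := eu g h; rewrite /e d1C => E; rewrite -[LHS](subrK (r (b (d1 C')) g h)) E; ring.
have [g gP] : exists g : D1 * D -> set (G -> G -> 'Z_2), forall C, H2 C -> g (dd C) = C.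
  have /choice[g gP] : forall t, exists C, forall C', H2 C' -> dd C' = t -> C = C'.
    move=> t; have [[C HC Ct]|nC] := pselect (exists2 C, H2 C & dd C = t).
      by exists C => C' HC' C't; apply: ddI; rewrite ?Ct.
    by exists set0 => C HC Ct; case: nC; exists C.
  by exists g => C HC; apply: gP.
apply: (@sub_finite_set _ _ (g @` [set: D1 * D])%classic).
  by move=> C HC; exists (dd C) => //; exact: gP.
by apply: finite_image; exact: finite_finset.
Qed.

End Cocycles.

(** * Isometries of balls *)

Section Geometry.
Local Open Scope ring_scope.

Section Walks.
Variable X : graph.

Fixpoint walk (x0 : X) (n : nat) (x : X) : Prop :=
  if n is n'.+1 then exists2 w, walk x0 n' w & adj w x else x = x0.

End Walks.

(** The bijection is global on vertices, which is available because the twisted graphs share their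
    vertex set; it respects adjacency only near [x0]. *)
Record local_iso (X Y : graph) (phi : X -> Y) (psi : Y -> X) (x0 : X) (N : nat) : Prop :=
  LocalIso {
    local_isoK : cancel phi psi;
    local_isoVK : cancel psi phi;
    local_iso_adj : forall n x x', (n <= N)%N -> walk x0 n x ->
      (adj x x' <-> adj (phi x) (phi x'))
  }.

Lemma local_iso_sym (X Y : graph) (phi : X -> Y) (psi : Y -> X) x0 N :
  local_iso phi psi x0 N -> local_iso psi phi (phi x0) N.
Proof.
move=> [phiK psiK iso]; split=> // n y y' nN wy.
have wx : walk x0 n (psi y).
  elim: n y nN wy {y'} => [|n IHn] y nN /=; first by move=> ->; rewrite phiK.
  move=> [w ww wy]; exists (psi w); first by apply: IHn => //; exact: ltnW.
  by apply/(iso n); rewrite ?psiK //; [exact: ltnW | apply: IHn => //; exact: ltnW].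
by rewrite (iso n) // !psiK.
Qed.

(** * Paths and distances in the geometric realization *)

Section Paths.
Variables (R : realType) (X : graph).
Implicit Types (p q : X -> R) (u v w x : X) (A : set (X -> R)) (l s t : R).

Lemma vertex_ptT x : vertex_pt R x x = 1.
Proof. by rewrite /vertex_pt asboolT. Qed.

Lemma vertex_ptF x w : w <> x -> vertex_pt R x w = 0.
Proof. by move=> wx; rewrite /vertex_pt asboolF. Qed.

Lemma adj_neq u v : adj u v -> u <> v.
Proof. by move=> uv E; rewrite E in uv; exact: adj_irrefl uv. Qed.

Lemma edge_ptl u v t : adj u v -> edge_pt u v t u = 1 - t.
Proof.
by move=> /adj_neq uv; rewrite /edge_pt vertex_ptT vertex_ptF // mulr1 mulr0 addr0.
Qed.

Lemma edge_ptr u v t : adj u v -> edge_pt u v t v = t.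
Proof.
move=> /adj_neq uv; rewrite /edge_pt vertex_ptT vertex_ptF ?mulr1 ?mulr0 ?add0r //.
by move=> /esym.
Qed.

Lemma edge_pt_supp u v t w : edge_pt u v t w != 0 -> w = u \/ w = v.
Proof.
have [->|wu] := pselect (w = u); first by left.
have [->|wv] := pselect (w = v); first by right.
by rewrite /edge_pt !vertex_ptF // !mulr0 addr0 eqxx.
Qed.

Lemma edge_pt0 u v : edge_pt u v 0 = vertex_pt R u.
Proof. by apply/funext => w; rewrite /edge_pt subr0 mul1r mul0r addr0. Qed.

Lemma edge_pt1 u v : edge_pt u v 1 = vertex_pt R v.
Proof. by apply/funext => w; rewrite /edge_pt subrr mul1r mul0r add0r. Qed.

Lemma edge_pt_realization u v t : adj u v -> 0 <= t <= 1 -> @realization R X (edge_pt u v t).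
Proof. by move=> uv t01; right; exists u, v, t. Qed.

Lemma piecewise_linear_ge0 A p q l : piecewise_linear A p q l -> 0 <= l.
Proof. by elim=> // u v s t r {}l _ _ _ _ _ l0; rewrite addr_ge0. Qed.

Lemma realization_connected x q : @realization R X q ->
  exists l, piecewise_linear (@realization R X) (vertex_pt R x) q l.
Proof.
have vpath y : forall r, (exists l, piecewise_linear (@realization R X) (vertex_pt R y) r l) ->
    forall z, clos_refl_trans X (@adj X) z y ->
    exists l, piecewise_linear (@realization R X) (vertex_pt R z) r l.
  move=> r yr z zy; have := clos_rt_rt1n _ _ _ _ zy; move: yr => {zy} + zy.
  elim: zy => [//|u v w uv _ IH wr].
  have [l' vr] := IH wr; exists (`|0 - 1| + l'); rewrite -(edge_pt0 u v).
  apply: PLcons; rewrite ?lexx ?ler01 //; last by rewrite edge_pt1.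
  by move=> c; rewrite (min_idPl ler01) (max_idPr ler01); exact: edge_pt_realization.
case=> [[y ->]|[u [v [t [uv t01 ->]]]]].
  apply: vpath (graph_connected x y); exists 0; apply: PLnil; left; by exists y.
apply: vpath (graph_connected x u); exists (`|0 - t| + 0); rewrite -(edge_pt0 u v).
case/andP: t01 => t0 t1.
apply: PLcons => //; rewrite ?lexx ?ler01 ?t0 //.
  move=> c; rewrite (min_idPl t0) (max_idPr t0) => /andP[c0 ct].
  by apply: edge_pt_realization => //; rewrite c0 (le_trans ct).
by apply: PLnil; apply: edge_pt_realization => //; rewrite t0.
Qed.

(* [within x0 p rho] says that the distance from [x0] to the point [p] is at
   most [rho]: it is the minimum of [n + 1 - p w] over the vertices [w] in the
   support of [p] and the lengths [n] of walks from [x0] to [w]. *)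
Definition within (x0 : X) p (rho : R) : Prop :=
  exists w n, [/\ walk x0 n w, p w != 0 & n%:R + 1 - p w <= rho].

Lemma within_vertex x0 : within x0 (vertex_pt R x0) 0.
Proof.
by exists x0, 0%N; rewrite vertex_ptT oner_neq0 add0r subrr.
Qed.

Lemma within_edge x0 u v s t rho : adj u v -> 0 <= s <= 1 -> 0 <= t <= 1 ->
  within x0 (edge_pt u v s) rho -> within x0 (edge_pt u v t) (rho + `|s - t|).
Proof.
move=> uv /andP[s0 s1] /andP[t0 t1] [w [n [wn ws wr]]].
have vu := adj_sym uv.
have h1 := ler_norm (s - t); have h2 := ler_norm (t - s); rewrite distrC in h2.
case: (edge_pt_supp ws) => E; rewrite E ?edge_ptl ?edge_ptr // in wn ws wr.
  (* At [t = 1] the vertex [u] leaves the support, and [v], one step further, replaces it as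
     witness. *)
  have [E1|t'] := eqVneq t 1.
    exists v, n.+1; rewrite E1 in h1 h2 *; rewrite edge_ptr // oner_neq0; split=> //; first by exists u.
    rewrite -natr1; lra.
  exists u, n; rewrite edge_ptl // subr_eq0 eq_sym; split=> //; lra.
have [E0|t'] := eqVneq t 0.
  exists u, n.+1; rewrite E0 in h1 h2 *; rewrite edge_ptl // subr0 oner_neq0; split=> //; first by exists v.
  rewrite -natr1; lra.
by exists v, n; rewrite edge_ptr //; split=> //; lra.
Qed.

Lemma within_path A x0 p q l rho : piecewise_linear A p q l ->
  within x0 p rho -> within x0 q (rho + l).
Proof.
move=> pq; elim: pq rho => [r _ rho|u v s t r {}l uv s01 t01 _ _ IH rho].
  by rewrite addr0.
by move=> /(within_edge uv s01 t01)/IH; rewrite addrA.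
Qed.

Lemma within_walk x0 u v s rho (N : nat) : adj u v -> 0 <= s <= 1 ->
  within x0 (edge_pt u v s) rho -> rho <= N%:R ->
  exists2 n, (n <= N)%N & walk x0 n u \/ walk x0 n v.
Proof.
move=> uv /andP[s0 s1] [w [n [wn ws wr]]] rN.
have nN : edge_pt u v s w <= 1 -> (n <= N)%N.
  by move=> w1; rewrite -(ler_nat R); lra.
by exists n; case: (edge_pt_supp ws) => E; rewrite E ?edge_ptl ?edge_ptr // in wn nN *;
  [apply: nN; lra | apply: nN | left | right].
Qed.

End Paths.

(** * Transport of paths and balls along a local isomorphism *)

Section Transport.
Variable R : realType.

Definition transport (X Y : graph) (psi : Y -> X) (p : X -> R) : Y -> R := p \o psi.

Section OneWay.
Variables (X Y : graph) (phi : X -> Y) (psi : Y -> X) (x0 : X) (N : nat) (r : R).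
Implicit Types (p q : X -> R).
Hypotheses (iso : local_iso phi psi x0 N) (rN : r + 1 <= N%:R).

Lemma transport_vertex x : transport psi (vertex_pt R x) = vertex_pt R (phi x).
Proof.
have [phiK psiK _] := iso.
apply/funext => y; rewrite /transport /=; have [->|yx] := pselect (y = phi x).
  by rewrite phiK !vertex_ptT.
by rewrite !vertex_ptF // => E; apply: yx; rewrite -E psiK.
Qed.

Lemma transport_edge u v (t : R) : transport psi (edge_pt u v t) = edge_pt (phi u) (phi v) t.
Proof.
apply/funext => y; have := transport_vertex u; have := transport_vertex v.
by move=> /(congr1 (fun f => f y)) Ev /(congr1 (fun f => f y)) Eu; rewrite /edge_pt -Eu -Ev.
Qed.

Lemma local_iso_edge u v (s rho : R) : adj u v -> 0 <= s <= 1 ->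
  within x0 (edge_pt u v s) rho -> rho <= N%:R -> adj (phi u) (phi v).
Proof.
move=> uv s01 w rhoN; have [_ _ isoA] := iso.
have [n nN [wu|wv]] := within_walk uv s01 w rhoN; first by apply/(isoA n).
by apply: adj_sym; apply/(isoA n) => //; exact: adj_sym.
Qed.

(** The path stays within [rho + l] of [x0], so each of its edges has an end reached by a walk of at
    most [N] steps, where [phi] respects adjacency. *)
Lemma transport_path p q l rho : piecewise_linear (@realization R X) p q l ->
  within x0 p rho -> rho + l <= N%:R -> (@realization R Y) (transport psi q) ->
  piecewise_linear (@realization R Y) (transport psi p) (transport psi q) l.
Proof.
move=> pq; elim: pq rho => [p' _ rho _ _ ?|u v s t q' {}l uv s01 t01 _ tq IH rho ws rhoN rq].
  exact: PLnil.
have l0 := piecewise_linear_ge0 tq.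
have uv' : adj (phi u) (phi v).
  apply: local_iso_edge ws _ => //; apply: le_trans rhoN.
  by rewrite lerDl addr_ge0.
rewrite transport_edge; apply: PLcons => //.
  move=> c /andP[mc cM]; apply: edge_pt_realization => //.
  move: mc cM s01 t01; rewrite ge_min le_max.
  by move=> /orP[?|?] /orP[?|?] /andP[? ?] /andP[? ?]; apply/andP; split; lra.
rewrite -transport_edge; apply: (IH (rho + `|s - t|)) => //.
  exact: within_edge ws.
by rewrite -addrA.
Qed.

(** The distance is an infimum, so paths to points of the ball are only controlled up to [eps]. With
    [eps] at most 1, the margin in [r + 1 <= N%:R] suffices. *)
Lemma near_path p : gball x0 r p -> forall eps, 0 < eps -> exists2 l, l < r + eps &
  piecewise_linear (@realization R X) (vertex_pt R x0) p l.
Proof.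
move=> [rp pr] eps eps0.
have [l0 xl0] := realization_connected x0 rp.
have [|l pl lt] := @inf_adherent R
    [set l | piecewise_linear (@realization R X) (vertex_pt R x0) p l] eps eps0.
  by split; [exists l0 | exists 0 => l; exact: piecewise_linear_ge0].
by exists l => //; apply: lt_le_trans lt _; rewrite lerD2r.
Qed.

Lemma near_within p : gball x0 r p -> within x0 p N%:R.
Proof.
move=> /near_path/(_ 1 ltr01)[l lr pl].
have [w [n [wn ws wr]]] := within_path pl (within_vertex R x0).
by exists w, n; split=> //; apply: le_trans wr _; rewrite add0r (le_trans (ltW lr)).
Qed.

Lemma near_edge u v (s : R) : adj u v -> 0 <= s <= 1 -> gball x0 r (edge_pt u v s) ->
  adj (phi u) (phi v).
Proof. by move=> uv s01 /near_within w; exact: local_iso_edge w _. Qed.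

Lemma transport_gball p : gball x0 r p -> gball (phi x0) r (transport psi p).
Proof.
move=> bp; have rp : realization (transport psi p).
  case: (bp) => -[[x E]|[u [v [t [uv t01 E]]]]] _; rewrite E in bp *.
    by rewrite transport_vertex; left; exists (phi x).
  rewrite transport_edge; apply: edge_pt_realization => //.
  exact: near_edge bp.
split=> //; apply/ler_addgt0Pr => eps eps0.
have e0 : 0 < Num.min eps 1 by rewrite lt_min eps0 ltr01.
have [l lr pl] := near_path bp e0.
apply: (@le_trans _ _ l); last first.
  by apply: ltW; apply: lt_le_trans lr _; rewrite lerD2l ge_min lexx.
apply: ge_inf; first by exists 0 => m; exact: piecewise_linear_ge0.
rewrite -transport_vertex; apply: (transport_path pl (within_vertex R x0)) => //.
rewrite add0r (le_trans (ltW lr)) // (le_trans _ rN) // lerD2l ge_min lexx orbT.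
by [].
Qed.

Lemma transport_gball_path p q l : piecewise_linear (gball x0 r) p q l ->
  piecewise_linear (gball (phi x0) r) (transport psi p) (transport psi q) l.
Proof.
elim=> [p' bp|u v s t q' {}l uv s01 t01 buv _ IH]; first exact/PLnil/transport_gball.
have bs : gball x0 r (edge_pt u v s) by apply: buv; rewrite ge_min le_max lexx.
rewrite transport_edge; apply: PLcons => //; first exact: near_edge bs.
  by move=> c /buv/transport_gball; rewrite transport_edge.
by rewrite -transport_edge.
Qed.

End OneWay.

Lemma local_iso_isometric (X Y : graph) (phi : X -> Y) (psi : Y -> X) x0 N (r : R) :
  local_iso phi psi x0 N -> r + 1 <= N%:R ->
  isometric (gball x0 r) (gball (phi x0) r).
Proof.
move=> iso rN; have iso' := local_iso_sym iso; have [phiK psiK _] := iso.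
have tK : cancel (transport psi) (transport phi).
  by move=> p; apply/funext => x; rewrite /transport /= phiK.
have tVK : cancel (transport phi) (transport psi).
  by move=> p; apply/funext => x; rewrite /transport /= psiK.
exists (transport psi); split.
  split.
  - by move=> p /(transport_gball iso rN).
  - by move=> p q _ _; exact: (can_inj tK).
  - move=> q /(transport_gball iso' rN); rewrite phiK => bq.
    by exists (transport phi q).
move=> p q bp bq; rewrite /intrinsic_dist; congr inf; apply/seteqP; split=> l /=.
  by move=> /(transport_gball_path iso' rN); rewrite phiK !tK.
exact: (transport_gball_path iso rN).
Qed.

End Transport.

End Geometry.

(** * Twisted graphs *)

Section TwistedGraph.
Local Open Scope group_scope.
Variables (H Ht : groupType) (pi : Ht -> H) (zeta : 'Z_2 -> Ht)
  (lift : H -> Ht) (A B : seq H) (sg : H -> Ht).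
Hypotheses (ext : central_ext pi zeta lift) (AV : forall a, a \in A -> a^-1 \in A)
  (AB : forall a, a \in A -> a \notin 1 :: B)
  (BV : forall b, b \in B -> b^-1 \in B) (B1 : 1 \notin B)
  (sgK : forall b, b \in B -> pi (sg b) = b)
  (sgV : forall b, b \in B -> sg b^-1 = (sg b)^-1)
  (gen : forall h, exists n, h \in wball (1 :: A ++ B) n).

Let tadj := twisted_adj pi zeta A B sg.
Let c0 : H -> H -> 'Z_2 := fun _ _ => 0%R.

Definition edge_symmetric (c : H -> H -> 'Z_2) : Prop :=
  forall h b, b \in B -> c (h * b) b^-1 = c h b.

Lemma twisted_adj_sym c : edge_symmetric c -> forall x y, tadj c x y -> tadj c y x.
Proof.
move=> cS x y; rewrite /tadj /twisted_adj.
have -> : y^-1 * x = (x^-1 * y)^-1 by gsimp.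
have -> : pi y = pi x * pi (x^-1 * y) by rewrite -(piM ext) mulVKg.
set k := x^-1 * y; rewrite (piV ext); case=> [->|kA|[kB E]].
- by constructor 1; rewrite (zetaV ext).
- by constructor 2; exact: AV.
constructor 3; split; first exact: BV.
by rewrite cS // sgV // {1}E invgM (zetaV ext) (zetaC ext).
Qed.

Lemma twisted_adj_irrefl c x : ~ tadj c x x.
Proof.
rewrite /tadj /twisted_adj mulVg (pi1 ext) => -[|A1|[B1' _]].
- by rewrite -(zeta0 ext) => /(zeta_inj ext).
- by have := AB A1; rewrite inE eqxx.
- by move/negP: B1; apply.
Qed.

Lemma twisted_neighbor c x k : k \in A ++ B -> exists2 y, tadj c x y & pi y = pi x * k.
Proof.
rewrite mem_cat => /orP[kA|kB].
  exists (x * lift k); last by rewrite (piM ext) (pi_liftK ext).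
  by constructor 2; rewrite mulKg (pi_liftK ext).
exists (x * sg k * zeta (c (pi x) k)).
  by constructor 3; rewrite -mulgA mulKg (pi_mul_zeta ext) sgK.
by rewrite (pi_mul_zeta ext) (piM ext) sgK.
Qed.

Lemma twisted_connected c x y : clos_refl_trans Ht (tadj c) x y.
Proof.
have [n hn] := gen ((pi x)^-1 * pi y).
suff [y' xy' y'y] : exists2 y', clos_refl_trans Ht (tadj c) x y' & pi y' = pi y.
  have [e ->] := pi_fiber ext y'y; apply: rt_trans xy' _.
  case: (Z2_cases e) => ->; first by rewrite (zeta0 ext) mulg1; exact: rt_refl.
  by apply: rt_step; constructor 1; rewrite mulKg.
rewrite -(mulVKg (pi x) (pi y)).
elim: n {y} (_ * pi y) hn => [|n IHn] h.
  by rewrite inE => /eqP ->; exists x; [exact: rt_refl | rewrite mulg1].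
case/allpairsP=> -[u k] /= [un kAB ->]; have [y xy yE] := IHn u un.
move: kAB; rewrite inE => /orP[/eqP ->|kAB]; first by exists y; rewrite ?mulg1.
have [z yz zE] := twisted_neighbor c y kAB.
exists z; last by rewrite zE yE mulgA.
by apply: rt_trans xy _; exact: rt_step.
Qed.

Lemma twisted_locally_finite c x : finite_set [set y | tadj c x y].
Proof.
pose s := [seq x * lift k * zeta e | k <- 1 :: A ++ B, e <- [:: 0%R; 1%R]].
apply: (@sub_finite_set _ _ [set` s]); last exact: finite_seq.
move=> y /= xy; have kAB := twisted_adj_label ext xy.
have [e E] : exists e, x^-1 * y = lift (pi (x^-1 * y)) * zeta e.
  by apply: (pi_fiber ext); rewrite (pi_liftK ext).
apply/allpairsP; exists (pi (x^-1 * y), e); split=> //=.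
  by case: (Z2_cases e) => ->; rewrite !inE eqxx ?orbT.
by rewrite -mulgA -E mulVKg.
Qed.

Definition twisted_graph c (cS : edge_symmetric c) : graph :=
  Graph (twisted_adj_sym cS) (@twisted_adj_irrefl c) (inhabits 1)
    (twisted_connected c) (twisted_locally_finite c).

Lemma edge_symmetric0 : edge_symmetric c0. Proof. by []. Qed.

Definition cayley_set : set Ht := [set k | tadj c0 1 k].

Lemma cayley_setE x y : cayley_set (x^-1 * y) <-> tadj c0 x y.
Proof. by rewrite /cayley_set /tadj /twisted_adj /= invg1 mul1g. Qed.

Lemma cayley_set_finite : finite_set cayley_set.
Proof. exact: twisted_locally_finite. Qed.

Lemma cayley_set_sym : symmetric_set cayley_set.
Proof.
move=> k /(twisted_adj_sym edge_symmetric0) k1.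
by rewrite -[k^-1]mulg1; apply/cayley_setE.
Qed.

Lemma cayley_set_gen : generates cayley_set.
Proof.
move=> x; have := clos_rt_rtn1 _ _ _ _ (twisted_connected c0 1 x).
elim=> [|y z yz _ [w [Sw yE]]].
  by exists [::]; rewrite big_nil; split.
exists (w ++ [:: y^-1 * z]); split; last by rewrite big_cat big_seq1 /= -yE mulVKg.
move=> k; rewrite mem_cat inE => /orP[/Sw //|/eqP ->]; left.
exact/cayley_setE.
Qed.

Let X : graph := cayley_graph cayley_set_finite cayley_set_sym cayley_set_gen.

Lemma cayley_adjE (x y : Ht) : @adj X x y <-> tadj c0 x y.
Proof.
split=> [[_ /cayley_setE //]|xy]; split; last exact/cayley_setE.
by move=> E; rewrite E in xy; exact: twisted_adj_irrefl xy.
Qed.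

(** A change of gauge: if the twist is the coboundary of [w] on the thin edges at [pi x], shifting
    each fibre by [w] untwists the edges at [x]. *)
Lemma twisted_shift (c : H -> H -> 'Z_2) (w : H -> 'Z_2) (x x' : Ht) :
  (forall b, b \in B -> w (pi x * b)%g - w (pi x) = c (pi x) b)%R ->
  tadj c0 x x' <-> tadj c (x * zeta (w (pi x))) (x' * zeta (w (pi x'))).
Proof.
move=> wc; rewrite /tadj /twisted_adj.
have -> : (x * zeta (w (pi x)))^-1 * (x' * zeta (w (pi x'))) =
    x^-1 * x' * zeta (w (pi x) + w (pi x'))%R.
  by rewrite invgM (zetaV ext) (zetaC ext _ x^-1) (zetaD ext) !mulgA
      -[in LHS](mulgA x^-1) (zetaC ext _ x') !mulgA.
rewrite !(pi_mul_zeta ext) (zeta0 ext) mulg1.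
have x'E : pi x' = pi x * pi (x^-1 * x') by rewrite -(piM ext) mulVKg.
move: x'E; set k := x^-1 * x' => x'E.
have wz : pi k = 1 -> (w (pi x) + w (pi x') = 0)%R.
  by rewrite x'E => ->; rewrite mulg1 -[LHS]add0r addrA Z2_addK.
have wt : pi k \in B -> (w (pi x) + w (pi x') = c (pi x) (pi k))%R.
  by move=> /wc <-; rewrite x'E Z2_oppr addrC.
split; case=> [E|kA|[kB E]]; try by constructor 2.
- by constructor 1; rewrite wz ?E ?(pi_zeta ext) // (zeta0 ext) mulg1.
- by constructor 3; split=> //; rewrite wt // {1}E.
- constructor 1; rewrite -E wz ?(zeta0 ext) ?mulg1 //.
  by rewrite -(pi_zeta ext 1%R) -E (pi_mul_zeta ext).
- constructor 3; split=> //; rewrite wt // in E.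
  exact: mulIg E.
Qed.

Lemma walk_label (x0 x : Ht) n : @walk X x0 n x ->
  (pi x0)^-1 * pi x \in wball (1 :: A ++ B) n.
Proof.
elim: n x => [|n IHn] x; first by move=> /= ->; rewrite mulVg inE.
move=> [y /IHn yn /cayley_adjE/(twisted_adj_label ext) yx].
have -> : (pi x0)^-1 * pi x = (pi x0)^-1 * pi y * pi (y^-1 * x).
  by rewrite (piM ext) (piV ext); gsimp.
by apply/allpairsP; exists ((pi x0)^-1 * pi y, pi (y^-1 * x)).
Qed.

(** The local isomorphism is the shift by a primitive of [c] on the ball; it is its own inverse
    since the kernel has exponent 2. *)
Lemma twisted_is_locally (R : realType) (r : R) N c (cS : edge_symmetric c) :
  (r + 1 <= N%:R)%R ->
  (forall h0, exists w : H -> 'Z_2, forall h, h0^-1 * h \in wball (1 :: A ++ B) N ->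
    forall b, b \in B -> (w (h * b)%g - w h = c h b)%R) ->
  is_locally r X (twisted_graph cS).
Proof.
move=> rN cW y; have [w wP] := cW (pi y).
pose f (x : Ht) := x * zeta (w (pi x)).
have ff : cancel f f.
  by move=> x; rewrite /f (pi_mul_zeta ext) -mulgA (zetaK ext) mulg1.
exists (f y); rewrite -[in gball y r](ff y).
apply: (@local_iso_isometric R X (twisted_graph cS) f f (f y) N) => //.
split=> // n x x' nN wx; rewrite cayley_adjE; apply: twisted_shift => b bB.
apply: wP => //; have := walk_label wx; rewrite (pi_mul_zeta ext).
apply: wballW nN; exact: mem_head.
Qed.

Definition rooted_covering c (q : Ht -> Ht) : Prop :=
  [/\ q 1 = 1, forall x y, tadj c0 x y -> tadj c (q x) (q y) &
      forall x y z, tadj c0 x y -> tadj c0 x z -> q y = q z -> y = z].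

(** Left translations are automorphisms of the Cayley graph, so a covering can be precomposed with
    one to fix [1]. *)
Lemma covered_rooted c (cS : edge_symmetric c) :
  covered_by (twisted_graph cS) X -> exists q, rooted_covering c q.
Proof.
move=> [q [qs qa qb]]; have [x0 _ qx0] := qs 1 I.
have adjM x y : tadj c0 x y -> @adj X (x0 * x) (x0 * y).
  move=> xy; apply/cayley_adjE; move: xy.
  by rewrite /tadj /twisted_adj invgM -mulgA mulKg.
exists (fun x => q (x0 * x)); split; first by rewrite mulg1.
  by move=> x y /adjM/qa.
move=> x y z xy xz E; have [_ qI _] := qb (x0 * x).
by apply: (mulgI x0); apply: qI E; rewrite inE /=; exact: adjM.
Qed.

End TwistedGraph.

(** * Comparison of two twists *)

Section CocycleTwist.
Local Open Scope group_scope.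
Variables (H : groupType) (P : pred H) (G : subGroupType P).
Implicit Types (h k b : H) (f : G -> G -> 'Z_2).

Lemma subgroup1 : P 1.
Proof. by have := valP (1 : G); rewrite val1. Qed.

Lemma subgroupM h k : P h -> P k -> P (h * k).
Proof.
move=> Ph Pk; have := valP ((Sub h Ph : G) * Sub k Pk).
by rewrite valM !SubK.
Qed.

Lemma val_groupV (x : G) : val x^-1 = (val x)^-1.
Proof. by apply: (mulgI (val x)); rewrite -valM !mulgV val1. Qed.

Lemma subgroupV h : P h -> P h^-1.
Proof. by move=> Ph; have := valP ((Sub h Ph : G)^-1); rewrite val_groupV SubK. Qed.

Lemma subgroupMr h k : P k -> P (h * k) = P h.
Proof.
move=> Pk; apply/idP/idP => Ph; last exact: subgroupM.
by rewrite -(mulgK k h); apply: subgroupM => //; exact: subgroupV.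
Qed.

Definition restr h : G := insubd 1 h.

Lemma val_restr h : P h -> val (restr h) = h.
Proof. by move=> Ph; rewrite insubdK. Qed.

Lemma restr_val (x : G) : restr (val x) = x.
Proof. exact: valKd. Qed.

Lemma restrM h k : P h -> P k -> restr (h * k) = restr h * restr k.
Proof. by move=> Ph Pk; apply: val_inj; rewrite valM !val_restr ?subgroupM. Qed.

Definition cocycle_twist f h b : 'Z_2 := if P h && P b then f (restr h) (restr b) else 0%R.

Variables B : seq H.
Hypothesis BP : forall b, b \in B -> P b.

(** In the cocycle identity for [h], [b], [b^-1], the terms at [(b, b^-1)] and [(h, 1)] vanish. *)
Lemma cocycle_twist_symmetric f : cocycle2 f -> f 1 1 = 0%R ->
  (forall b, b \in B -> f (restr b) (restr b^-1) = 0%R) ->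
  edge_symmetric B (cocycle_twist f).
Proof.
move=> cf f11 fB h b bB; have Pb := BP bB.
rewrite /cocycle_twist subgroupMr // (subgroupV Pb) Pb !andbT; case: ifP => // Ph.
have := cf (restr h) (restr b) (restr b^-1).
rewrite fB // -!restrM ?subgroupV // mulgV [restr 1](_ : _ = 1); last first.
  by apply: val_inj; rewrite val_restr ?val1 // subgroup1.
rewrite (cocycle2_right1 _ cf) f11 add0r addr0 => /eqP; rewrite subr_eq0 => /eqP <-.
by rewrite Z2_oppr.
Qed.

(** If the ball around [h0] misses [G], the twist vanishes there. Otherwise pick [h1] in both; the
    primitive is [f (h1, h1^-1 * h)], by the cocycle identity for [h1], [h1^-1 * h], [b], whose term
    [f (h1^-1 * h, b)] is zero by hypothesis. *)
Lemma cocycle_twist_local f (K : seq H) h0 : cocycle2 f ->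
  (forall k k' b, k \in K -> k' \in K -> b \in B -> f (restr (k^-1 * k')) (restr b) = 0%R) ->
  exists w : H -> 'Z_2, forall h, h0^-1 * h \in K ->
    forall b, b \in B -> (w (h * b)%g - w h = cocycle_twist f h b)%R.
Proof.
move=> cf fK; have [[h1 h1K Ph1]|no] := pselect (exists2 h1, h0^-1 * h1 \in K & P h1); last first.
  exists (fun=> 0%R) => h hK b bB; rewrite subrr /cocycle_twist.
  by case: ifP => // /andP[Ph _]; case: no; exists h.
exists (fun h => if P h then f (restr h1) (restr (h1^-1 * h)) else 0%R) => h hK b bB.
have Pb := BP bB; rewrite /cocycle_twist subgroupMr // Pb andbT.
case: ifP => Ph; last by rewrite subrr.
have P1h : P (h1^-1 * h) by rewrite subgroupM ?subgroupV.
have := cf (restr h1) (restr (h1^-1 * h)) (restr b).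
rewrite -!restrM // mulVKg mulgA.
have := fK _ _ b h1K hK bB; rewrite invgM invgK mulgA mulgK => -> E.
by apply/eqP; rewrite -subr_eq0 -E; apply/eqP; ring.
Qed.

End CocycleTwist.

Section Comparison.
Local Open Scope group_scope.
Variables (H Ht : groupType) (pi : Ht -> H) (zeta : 'Z_2 -> Ht)
  (lift : H -> Ht) (A : seq H) (sg : H -> Ht)
  (P : pred H) (G : subGroupType P) (T : seq H) (g : H).
Hypotheses (ext : central_ext pi zeta lift).
Hypotheses (T1 : 1 \in T) (gT : g \in T) (TV : forall t, t \in T -> t^-1 \in T)
  (ginf : has_infinite_order g) (TP : forall t, t \in T -> P t)
  (Tgen : forall h, P h -> exists n, h \in wball T n).

(** The radius is that of [keeps_labels], so recognizing thin labels up to inversion yields exactly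
    that property. *)
Definition thin_labels : seq H := [seq t <- wball T 4 | t != 1].

Let B := thin_labels.

Hypotheses (sA : sym_set A) (AB : forall a, a \in A -> a \notin 1 :: B)
  (sep : separated A B)
  (few : forall w, w \in A ++ B ->
    2 * count (fun k => k^-1 * w \in 1 :: A ++ B) (undup (1 :: A ++ B)) < size A)
  (sgK : forall b, b \in B -> pi (sg b) = b).

Lemma thin_labels1 : 1 \notin B.
Proof. by rewrite mem_filter eqxx. Qed.

Lemma thin_labelsV b : b \in B -> b^-1 \in B.
Proof. by rewrite !mem_filter invg_eq1 => /andP[-> bT]; exact: wballV. Qed.

Lemma wball_subgroup n t : t \in wball T n -> P t.
Proof.
elim: n t => [|n IHn] t; first by rewrite inE => /eqP ->; exact: (subgroup1 G).
by case/allpairsP=> -[u s] /= [/IHn Pu /TP Ps ->]; exact: (subgroupM G).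
Qed.

Lemma thin_labels_subgroup b : b \in B -> P b.
Proof. by rewrite mem_filter => /andP[_]; exact: wball_subgroup. Qed.

Let T4 t : t \in T -> t \in wball T 4.
Proof. by move=> tT; apply: (@wballW _ T 1) => //; exact: wball1. Qed.

Lemma rooted_covering_labelling c q : rooted_covering pi zeta A B sg c q ->
  rooted_labelling T (base_map pi lift q).
Proof.
move=> [q1 qadj qinj]; have bE := base_mapE ext sA few qadj qinj.
have lT t : t \in wball T 4 -> t = 1 \/ t \in B.
  by move=> tT; rewrite mem_filter tT andbT; case: eqVneq; [left | right].
have b1 : base_map pi lift q 1 = 1 by rewrite -(pi1 ext) -bE q1.
split=> //.
  move=> x t /lT[->|tB]; first by left; rewrite !mulg1.
  rewrite label_mapE.
  by have [->|->] := label_map_sign ext sA AB thin_labels1 sep few sgK qadj qinj x tB;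
    [left|right].
have lB t : t \in B -> base_map pi lift q t \in B.
  move=> tB; have := label_map_thin ext sA AB thin_labels1 few sgK qadj qinj 1 tB.
  by rewrite /label_map b1 mul1g invg1 mul1g.
move=> s t /T4/lT[->|sB] /T4/lT[->|tB] //; rewrite ?b1.
- by move=> E; have := lB _ tB; rewrite -E (negPf thin_labels1).
- by move=> E; have := lB _ sB; rewrite E (negPf thin_labels1).
move=> E; apply: (label_map_thin_inj ext sA AB thin_labels1 few sgK qadj qinj (h := 1)) => //.
by rewrite /label_map !mul1g E.
Qed.

Lemma restr_gen (x : G) : exists n, x \in wball [seq restr G b | b <- B] n.
Proof.
have [n] := Tgen (valP x); rewrite -[x in exists n, x \in _](restr_val x).
elim: n (val x) => [|n IHn] h.
  rewrite inE => /eqP ->; exists 0%N; rewrite inE; apply/eqP/val_inj.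
  by rewrite val_restr ?val1 // (subgroup1 G).
case/allpairsP=> -[u t] /= [un tT ->]; have [m um] := IHn u un.
have [->|t1] := eqVneq t 1; first by exists m; rewrite mulg1.
exists m.+1; rewrite (restrM _ (wball_subgroup un) (TP tT)).
by apply: allpairs_f => //; apply: map_f; rewrite mem_filter t1 T4.
Qed.

Lemma rooted_covering_cohomologous (f f' : G -> G -> 'Z_2) q q' :
  cocycle2 f -> cocycle2 f' ->
  rooted_covering pi zeta A B sg (cocycle_twist f) q ->
  rooted_covering pi zeta A B sg (cocycle_twist f') q' ->
  {in T, base_map pi lift q =1 base_map pi lift q'} -> cohomologous f f'.
Proof.
move=> cf cf' rq rq' qT.
have lq := rooted_covering_labelling rq; have lq' := rooted_covering_labelling rq'.
set rho := base_map pi lift q in qT lq; set rho' := base_map pi lift q' in qT lq'.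
have rhoE h : P h -> rho' h = rho h.
  by move=> /Tgen[n hn]; symmetry; exact: (rooted_labelling_uniq T1 gT TV ginf lq lq' qT hn).
have rhoK h : P h -> rho (rho h) = h.
  by move=> /Tgen[n hn]; exact: (rooted_labelling_invol T1 gT TV ginf lq hn).
have rhoP h : P h -> P (rho h).
  move=> /Tgen[n hn]; apply: (@wball_subgroup n).
  by have [k r1 _] := lq; exact: (keeps_labels_gen T1 TV k r1 hn).
have [q1 qadj qinj] := rq; have [q1' qadj' qinj'] := rq'.
have qE := base_mapE ext sA few qadj qinj.
have qE' := base_mapE ext sA few qadj' qinj'.
have qz := covering_zeta ext sA few qadj qinj.
have qz' := covering_zeta ext sA few qadj' qinj'.
(* Both coverings induce the same map over [G], so there they differ by a kernel element depending
   only on the fibre. *)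
have [u uE] : exists u : H -> 'Z_2, forall x, P (pi x) -> q' x = q x * zeta (u (pi x)).
  have /choice[u uP] : forall h, exists e, P h -> q' (lift h) = q (lift h) * zeta e.
    move=> h; have [Ph|nP] := pselect (P h); last by exists 0%R.
    have [|e eP] := @pi_fiber _ _ _ _ _ ext (q (lift h)) (q' (lift h)); last by exists e.
    by rewrite qE qE' (pi_liftK ext); symmetry; exact: rhoE.
  exists u => x Px; have [e E] : exists e, x = lift (pi x) * zeta e.
    by apply: (pi_fiber ext); rewrite (pi_liftK ext).
  by rewrite {1 2}E qz qz' uP // -!mulgA (zetaC ext).
(* Applying [thin_edge] to both coverings on the same edge relates the values of [u] at its ends to
   the two twists. *)
have step h b : P h -> b \in B ->
    (u (h * b)%g + u h = cocycle_twist f' (rho h) (label_map pi lift q h b)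
                     + cocycle_twist f (rho h) (label_map pi lift q h b))%R.
  move=> Ph bB; have Pb := thin_labels_subgroup bB.
  have Phb : P (h * b) by exact: (subgroupM G).
  have lE : label_map pi lift q' h b = label_map pi lift q h b.
    by rewrite /label_map -/rho -/rho' !rhoE.
  have := thin_edge ext sA AB thin_labels1 few sgK qadj' qinj' (lift h) bB.
  have := thin_edge ext sA AB thin_labels1 few sgK qadj qinj (lift h) bB.
  have piE : pi (lift h * sg b) = h * b by rewrite (piM ext) (pi_liftK ext) sgK.
  rewrite !uE ?piE ?(pi_liftK ext) // lE -/rho -/rho' rhoE // => ->.
  set l := label_map _ _ _ _ _; set s := sg l.
  rewrite -!mulgA => /mulgI; rewrite (zetaC ext (u h)) -!mulgA => /mulgI.
  rewrite -!(zetaD ext) => /(zeta_inj ext) E.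
  exact: Z2_exchange E.
(* As [rho] is an involution of [G], the edge at [rho (val k)] labelled by the image of [b] is
   mapped to the edge at [k] labelled [b]. Reading [step] there makes [f' - f] the coboundary of [v]
   on generators. *)
pose v (k : G) := u (rho (val k)).
apply: (cohomologous_of_cochain cf cf' restr_gen (v := v)) => k x /mapP[b bB ->].
have Pk := valP k; have Pb := thin_labels_subgroup bB.
have lB := label_map_thin ext sA AB thin_labels1 few sgK qadj qinj (val k) bB.
have hE : rho (val k) * label_map pi lift q (val k) b = rho (val k * b) by exact: mulVKg.
have := step (rho (val k)) _ (rhoP _ Pk) lB.
have -> : label_map pi lift q (rho (val k)) (label_map pi lift q (val k) b) = b.
  by rewrite [LHS]/label_map -/rho hE !rhoK ?mulKg //; exact: (subgroupM G).
rewrite hE rhoK // /v valM val_restr // /cocycle_twist Pk Pb !restr_val => E.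
have -> : (f' k (restr G b) - f k (restr G b) = f' k (restr G b) + f k (restr G b))%R.
  by rewrite Z2_oppr.
by rewrite -E Z2_oppr.
Qed.

End Comparison.

(** * Generators and lifts *)

Section Preparation.
Local Open Scope group_scope.
Variable H : groupType.

Lemma wballS (T T' : seq H) n : {subset T <= T'} -> {subset wball T n <= wball T' n}.
Proof.
move=> TT'; elim: n => [//|n IHn] _ /allpairsP[[u t] /= [un tT ->]].
by apply: allpairs_f; [exact: IHn | exact: TT'].
Qed.

Lemma prod_wball (T : seq H) (w : seq H) : {subset w <= T} ->
  \prod_(x <- w) x \in wball T (size w).
Proof.
elim: w => [|x w IHw] wT; first by rewrite big_nil inE.
rewrite big_cons; apply: (@wballM _ _ 1); first by apply: wball1; apply: wT; exact: mem_head.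
by apply: IHw => y yw; apply: wT; rewrite inE yw orbT.
Qed.

Lemma finitely_presented_gen : finitely_presented H ->
  exists U : seq H, forall h, exists n, h \in wball U n.
Proof.
move=> [m [a [_ [ev _]]]].
pose U := [seq a i | i : 'I_m] ++ [seq (a i)^-1 | i : 'I_m].
exists U => h; have [w <-] := ev h; exists (size w).
rewrite /word_eval -(big_map (fun l => if l.2 then (a l.1)^-1 else a l.1) predT id).
rewrite -(size_map (fun l => if l.2 then (a l.1)^-1 else a l.1)); apply: prod_wball.
move=> _ /mapP[[i []] _ ->] /=; rewrite mem_cat; apply/orP; [right|left];
  by apply/codomP; exists i.
Qed.

(** Whichever of [b], [b^-1] comes first in [B] keeps its lift, and the other gets the inverse lift.
    Only [b = b^-1] leaves no choice: there the lift itself must square to [1]. *)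
Lemma exists_symmetric_lift (Ht : groupType) (pi : Ht -> H) (zeta : 'Z_2 -> Ht) lift (B : seq H) :
  central_ext pi zeta lift ->
  (forall b, b \in B -> b = b^-1 -> lift b * lift b = 1) ->
  exists sg : H -> Ht, (forall b, pi (sg b) = b) /\
    (forall b, b \in B -> sg b^-1 = (sg b)^-1).
Proof.
move=> ext inv2.
exists (fun b => if index b B <= index b^-1 B then lift b else (lift b^-1)^-1); split=> [b|b bB].
  by case: ifP => _; rewrite ?(piV ext) (pi_liftK ext) ?invgK.
rewrite invgK; have [bV|bV] := eqVneq b b^-1.
  rewrite -!bV leqnn; apply: (mulgI (lift b)).
  by rewrite mulgV inv2.
have nI : index b B != index b^-1 B.
  apply: contra bV => /eqP E; have bB' : b^-1 \in B by rewrite -index_mem -E index_mem.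
  by rewrite -[X in X == _](nth_index 1 bB) E nth_index.
by case: (ltngtP (index b B) (index b^-1 B)) nI => // _ _; rewrite ?invgK.
Qed.

(** The kernel is normal of order 2, hence central: conjugation fixes its only non-trivial
    element. *)
Lemma kernel_central_ext (Ht : groupType)
    (iota : {multiplicative 'Z_2 -> Ht}) (pi : {multiplicative Ht -> H}) :
  injective iota -> range iota = [set x | pi x = 1] ->
  set_surj [set: Ht] [set: H] pi -> exists lift, central_ext pi iota lift.
Proof.
move=> inj ker surj.
have [lift liftE] : exists lift : H -> Ht, cancel lift pi.
  have /choice[lift liftP] : forall h, exists x, pi x = h.
    by move=> h; have [x _ <-] := surj h I; exists x.
  by exists lift.
have kerE x : pi x = 1 <-> exists e, x = iota e.
  split=> [xK|[e ->]].
    have : range iota x by rewrite ker.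
    by move=> [e _ <-]; exists e.
  have : range iota (iota e) by exists e.
  by rewrite ker.
have iotaD : {morph iota : e f / (e + f)%R >-> e * f} by move=> e f; exact: gmulfM.
have iota0 : iota 0%R = 1 by apply: (mulgI (iota 0%R)); rewrite -iotaD mulg1 addr0.
exists lift; split; first exact: gmulfM.
split=> // e x.
have [|e' E] := (kerE (x^-1 * iota e * x)).1.
  by rewrite !gmulfM (kerE (iota e)).2 ?mulg1 -?gmulfM ?mulVg; [apply/kerE; exists 0%R|exists e].
have -> : iota e * x = x * iota e' by rewrite -E; gsimp.
congr (_ * iota _); case: (Z2_cases e) E => ->.
  by rewrite iota0 mulg1 mulVg -iota0 => /inj.
case: (Z2_cases e') => -> // E; have : iota 1%R = iota 0%R.
  by rewrite iota0; apply: (mulgI x^-1); apply: (mulIg x); rewrite E iota0 mulg1 mulVg.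
by move/inj.
Qed.

End Preparation.

Lemma subgroup_gen (H : groupType) (P : pred H) (G : subGroupType P) (g : G) :
  finitely_generated G -> exists T : seq H,
  [/\ 1%g \in T, val g \in T, forall t, t \in T -> t^-1%g \in T,
      forall t, t \in T -> P t & forall h, P h -> exists n, h \in wball T n].
Proof.
move=> [S /finite_seqP[s sE] genS].
pose T0 := 1%g :: g :: s; pose T1 := [seq val t | t <- T0] ++ [seq (val t)^-1%g | t <- T0].
have T1V t : t \in T0 -> val t \in T1 /\ (val t)^-1%g \in T1.
  move=> tT; rewrite !mem_cat; split; apply/orP; [left|right]; last by apply/mapP; exists t.
  exact: map_f.
have T1P t : t \in T1 -> exists2 x : G, x \in T0 & t = val x \/ t = (val x)^-1%g.
  rewrite mem_cat => /orP[] /mapP[x xT ->]; exists x => //; [by left|by right].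
exists T1; split=> [|||t /T1P[x _ [] ->]|h Ph].
- by rewrite -(val1 G); apply (T1V 1%g); rewrite inE eqxx.
- by apply (T1V g); rewrite !inE eqxx orbT.
- by move=> t /T1P[x /T1V[xT xT'] [] ->]; rewrite ?invgK.
- exact: valP.
- by rewrite -val_groupV; exact: valP.
have [w [wS E]] := genS (Sub h Ph : G); exists (size w).
have -> : h = (\prod_(x <- [seq val x | x <- w]) x)%g.
  rewrite big_map -[LHS](SubK G Ph) E.
  by elim: (w) => [|x w' IHw]; rewrite ?big_nil ?big_cons ?val1 // valM IHw.
rewrite -(size_map val); apply: prod_wball => _ /mapP[x /wS xw ->].
have sT y : S y -> y \in T0 by rewrite sE /= !inE => ->; rewrite !orbT.
case: xw => /sT/T1V[] //; by rewrite val_groupV invgK.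
Qed.

(** * Rigidity at some scale contradicts the infinitude of the second cohomology of [G] *)

Theorem theorem7 (R : realType) (H Ht : groupType)
    (iota : {multiplicative 'Z_2 -> Ht}) (pi : {multiplicative Ht -> H})
    (P : pred H) (G : subGroupType P) :
  finitely_presented H ->
  injective iota ->
  range iota = [set x | pi x = 1%g] ->
  set_surj [set: Ht] [set: H] pi ->
  finitely_generated G ->
  infinite_set (@H2 G) ->
  (exists g : G, has_infinite_order g) ->
  (forall g : G, has_order 2 g ->
     forall x : Ht, pi x = val g -> has_order 2 x) ->
  exists (S : set Ht) (finS : finite_set S) (symS : symmetric_set S)
    (genS : generates S),
    ~ LG_rigid R (cayley_graph finS symS genS).
Proof.
move=> /finitely_presented_gen[U Ugen] inj ker surj Gfg infH2 [g ginf] order2.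
have [lift ext] := kernel_central_ext inj ker surj.
have [T [T1 gT TV TP Tgen]] := subgroup_gen g Gfg.
have gHinf : has_infinite_order (val g).
  move=> n n0 E; apply: (ginf n n0); apply: val_inj; rewrite val1 -E.
  by elim: n {n0 E} => [|n IHn]; rewrite ?val1 // !expgS valM IHn.
pose B := thin_labels T.
have B1 : 1%g \notin B := thin_labels1 T.
have BV : forall b, b \in B -> b^-1%g \in B := thin_labelsV TV.
have BP : forall b, b \in B -> P b := thin_labels_subgroup G TP.
have [A [sA AB UAB sep few]] := fat_set_exists U gHinf BV B1.
have [sg [sgK sgV]] : exists sg : H -> Ht, (forall b, pi (sg b) = b) /\
    (forall b, b \in B -> sg b^-1 = (sg b)^-1)%g.
  (* As [1] is not in [B], a thin label equal to its inverse has order exactly 2, so the hypothesis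
     on preimages applies to its lift. *)
  apply: (exists_symmetric_lift ext) => b bB bV.
  have b1 : restr G b <> 1%g.
    move=> E; have := val_restr G (BP b bB); rewrite E val1 => b1.
    by rewrite -b1 in bB; move/negP: B1; apply.
  have [_ + _] : has_order 2 (lift b).
    apply: (order2 (restr G b)); last by rewrite val_restr ?(pi_liftK ext) // BP.
    split=> // [|[|[|m]] //= _].
    by rewrite expg2 -restrM ?BP // {1}bV mulVg; apply: val_inj; rewrite val_restr ?val1 // (subgroup1 G).
  by rewrite expg2.
have gen h : exists n, h \in wball (1%g :: A ++ B) n.
  by have [n hn] := Ugen h; exists n; apply: wballS hn => u; exact: UAB.
have sgK' b (_ : b \in B) := sgK b.
have AV := sA.2.
exists (cayley_set pi iota A B sg), (cayley_set_finite A B sg ext),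
  (cayley_set_sym ext AV BV sgV), (cayley_set_gen ext sgK' gen).
move=> [r [r0 rig]].
pose N := Num.bound (r + 1)%R.
have rN : (r + 1 <= N%:R)%R by apply/ltW/archi_boundP; rewrite addr_ge0 // ltW.
pose K := wball (1%g :: A ++ B) N.
(* Vanishing at [(1, 1)] and all [(b, b^-1)] makes the twisted adjacency symmetric; vanishing at all
   [(k^-1 * k', b)] makes the twist a coboundary on balls of radius [N]. *)
pose L := (1%g, 1%g) :: [seq (restr G b, restr G b^-1%g) | b <- B] ++
  [seq (restr G kk, restr G b) | kk <- [seq (k^-1 * k')%g | k <- K, k' <- K], b <- B].
have good f : cocycle2 f -> (forall p, p \in L -> f p.1 p.2 = 0%R) ->
    exists q, rooted_covering pi iota A B sg (cocycle_twist f) q.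
  move=> cf fL.
  have cS : edge_symmetric B (cocycle_twist f).
    apply: cocycle_twist_symmetric => // [|b bB].
      exact: (fL (1%g, 1%g) (mem_head _ _)).
    apply: (fL (restr G b, restr G b^-1%g)); rewrite inE mem_cat; apply/orP; right.
    by apply/orP; left; apply/mapP; exists b.
  apply: (@covered_rooted _ _ _ _ _ _ _ _ ext AV AB BV B1 sgK' sgV gen _ cS); apply: rig.
  apply: twisted_is_locally rN _ => h0; apply: cocycle_twist_local => // k k' b kK k'K bB.
  apply: (fL (restr G (k^-1 * k')%g, restr G b)); rewrite inE mem_cat; apply/orP; right.
  by apply/orP; right; apply: allpairs_f => //; exact: allpairs_f.
have [Q QP] : exists Q : (G -> G -> 'Z_2) -> Ht -> Ht, forall f, cocycle2 f ->
    (forall p, p \in L -> f p.1 p.2 = 0%R) ->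
    rooted_covering pi iota A B sg (cocycle_twist f) (Q f).
  have /choice[Q QP] : forall f : G -> G -> 'Z_2, exists q, cocycle2 f ->
      (forall p, p \in L -> f p.1 p.2 = 0%R) ->
      rooted_covering pi iota A B sg (cocycle_twist f) q.
    move=> f; have [[cf fL]|nf] := pselect (cocycle2 f /\ forall p, p \in L -> f p.1 p.2 = 0%R).
      by have [q qP] := good f cf fL; exists q.
    by exists id => cf fL; case: nf.
  by exists Q.
(* The induced map sends each [t] in [T] to [t] or [t^-1], so recording whether it fixes [t]
   determines it on [T], with finitely many outcomes. *)
pose d f : {ffun 'I_(size T) -> bool} :=
  [ffun i => base_map pi lift (Q f) (tnth (in_tuple T) i) == tnth (in_tuple T) i].
have [f [f' [[cf cf'] fL df nff]]] := infinite_H2_pigeonhole L d infH2.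
have rf := QP f cf (fun p pL => (fL p pL).1).
have rf' := QP f' cf' (fun p pL => (fL p pL).2).
have lab := rooted_covering_labelling ext T1 sA AB sep few sgK'.
apply: nff; apply: (rooted_covering_cohomologous ext T1 gT TV gHinf TP Tgen sA AB sep few sgK' cf cf' rf rf').
move=> t tT; have [k1 b1 _] := lab _ _ rf; have [k1' b1' _] := lab _ _ rf'.
have /tnthP[i ti] : t \in in_tuple T by [].
have tw : t \in wball T 4 by apply: (@wballW _ T 1) => //; exact: wball1.
have /ffunP/(_ i) := df; rewrite !ffunE -ti.
have := k1 1%g t tw; have := k1' 1%g t tw; rewrite b1 b1' !mul1g => -[->|->] [->|->] //.
  by rewrite eqxx => /eqP.
by rewrite eqxx => /esym/eqP.
Qed.
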